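(* Let $Z$ be a Banach space. For $i=0,1$ let $X_i$ be a separable Banach space, $Y_i$ a closed linear subspace of $X_i$, and $Q_i:Y_i\to Z$ a quotient mapping onto $Z$. Suppose that the following dimensional constraints hold: (a) the dimensions of $Y_0$ and $Y_1$ are equal; (b) the codimensions of $Y_0$ in $X_0$ and of $Y_1$ in $X_1$ are equal; (c) the dimensions of the kernels of $Q_0$ and $Q_1$ are equal. Suppose further that $0<\epsilon<1$, that $0<\theta_0\le\theta_1<1$, and that $V_0$ and $V_1$ are any infinite dimensional separable Banach spaces. Then there are a Banach couple $(A_0,A_1)$, a linear subspace $W$ of $A_0+A_1$, and linear maps $P:W\to Z$ and $E:Z\to W$ with the following properties: (i) $A_0$ is isometric to $X_0\oplus V_0$, and $A_1$ is isometric to $X_1\oplus V_1$; (ii) $P\circ E=\mathrm{Id}_Z$; and, whenever $I$ is an exponential interpolation method of exponent $\theta$ (for some $0<\theta<1$), (iii) $A_I\subseteq W$ and $\|P\|_{A_I\to Z}<\infty$ (with $\|P\|_{A_I\to Z}<1+\epsilon/3$ if $I$ is exact exponential and $\theta_0\le\theta\le\theta_1$); (iv) $E(Z)\subseteq A_I$ and $\|E\|_{Z\to A_I}<\infty$ (with $\|E\|_{Z\to A_I}<1+\epsilon/3$ if $I$ is exact exponential and $\theta_0\le\theta\le\theta_1$). Thus $Z$ is isomorphic to a complemented subspace of $A_I$. (If $I$ is exact exponential and $\theta_0\le\theta\le\theta_1$, then $Z$ is $(1+\epsilon)$-isomorphic to a $(1+\epsilon)$-complemented subspace of $A_I$.)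
   Context: Scalars are real or complex. A quotient mapping $Q:Y\to Z$ is a bounded linear surjection for which the norm of $Z$ is the quotient norm, $\|z\|=\inf\{\|y\|:Qy=z\}$. $X\oplus V$ denotes the Banach space of ordered pairs $(x,v)$ with norm $\|(x,v)\|=\|x\|+\|v\|$. A Banach couple $(A_0,A_1)$ is a pair of Banach spaces both (continuously) embedded in a common (Hausdorff) topological vector space, called the ambient space. $A_0+A_1$ has norm $\|x\|=\inf\{\|x_0\|_{A_0}+\|x_1\|_{A_1}:x_0\in A_0,\ x_1\in A_1,\ x_0+x_1=x\}$ and $A_0\cap A_1$ has norm $\|x\|=\max\{\|x\|_{A_0},\|x\|_{A_1}\}$. A map $T:(A_0,A_1)\to(B_0,B_1)$ between couples is a linear map $T:A_0+A_1\to B_0+B_1$ with $T(A_i)\subseteq B_i$ and $\|T\|_{A_i\to B_i}<\infty$ for $i=0,1$. An interpolation method $I$ is a functor that takes each Banach couple $(A_0,A_1)$ to a Banach space $A_I$ with $A_0\cap A_1\subseteq A_I\subseteq A_0+A_1$ such that, for a constant $c$ depending only on $I$, $$c^{-1}\|x\|_{A_0+A_1}\le\|x\|_{A_I}\le c\,\|x\|_{A_0\cap A_1},\qquad(1)$$ and such that if $T:(A_0,A_1)\to(B_0,B_1)$ is a map between couples then $T(A_I)\subseteq B_I$ with $\|T\|_{A_I\to B_I}<\infty$. It is exponential with exponent $\theta$ if $0<\theta<1$ and, for a constant $c$ depending only on $I$, for every map $T:(A_0,A_1)\to(B_0,B_1)$ between couples, $$\|T\|_{A_I\to B_I}\le c\,\|T\|_{A_0\to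 B_0}^{1-\theta}\|T\|_{A_1\to B_1}^{\theta}.\qquad(2)$$ It is exact exponential (in short, exact) if it is exponential and $c=1$ in both inequalities (1) and (2). *)

(* Defs.v *)
From HB Require Import structures.
From mathcomp Require Import all_boot all_order all_algebra.
From mathcomp Require Import all_classical all_reals all_analysis.
From mathcomp Require Import complex.

Set Implicit Arguments.
Unset Strict Implicit.
Unset Printing Implicit Defensive.

Import Order.TTheory GRing.Theory Num.Theory.
Import numFieldNormedType.Exports.

Local Open Scope classical_set_scope.
Local Open Scope ring_scope.

Variant scalar_kind := RealScalars | ComplexScalars.

Definition scalar_field (R : realType) (s : scalar_kind) : numFieldType :=
  match s return numFieldType with
  | RealScalars => R
  | ComplexScalars => R[i]
  end.

Definition scalar_re (R : realType) (s : scalar_kind) : scalar_field R s -> R :=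
  match s return scalar_field R s -> R with
  | RealScalars => fun a => a
  | ComplexScalars => fun a => complex.Re a
  end.

(* The library's norm [`|x|] takes its values in the scalar field; [nrm x] is
   the same number, read in R. *)
Definition nrm (R : realType) (s : scalar_kind)
    (X : normedModType (scalar_field R s)) (x : X) : R := scalar_re `|x|.

Section linear_algebra.
Variable K : numFieldType.

Definition linear_on (U V : lmodType K) (D : set U) (f : U -> V) : Prop :=
  forall (a : K) (x y : U), D x -> D y -> f (a *: x + y) = a *: f x + f y.

Definition linear_subspace (U : lmodType K) (D : set U) : Prop :=
  D 0 /\ forall (a : K) (x y : U), D x -> D y -> D (a *: x + y).

(* [e] induces a basis of the quotient space D / N. *)
Definition basis_mod (U : lmodType K) (D N : set U) (n : nat)
    (e : 'I_n -> U) : Prop :=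
  (forall i, D (e i)) /\
  forall u, D u -> exists! c : {ffun 'I_n -> K},
    N (u - \sum_(i < n) c i *: e i).

(* The dimension of D / N, with [None] standing for infinite dimension: all
   infinite dimensions are identified. (An infinite dimensional separable
   Banach space has algebraic dimension the continuum anyway.) *)
Definition dim_mod (U : lmodType K) (D N : set U) : option nat :=
  if pselect (exists n, exists e : 'I_n -> U, basis_mod D N e) is left h
  then Some (projT1 (cid h)) else None.

Definition dimension (U : lmodType K) (D : set U) : option nat := dim_mod D [set 0].

Definition codimension (U : lmodType K) (D : set U) : option nat := dim_mod setT D.

End linear_algebra.

Definition separable_space (T : topologicalType) : Prop :=
  exists S : set T, countable S /\ dense S.

(* sup { q (f x) : x in D, p x <= 1 } *)
Definition opnorm (R : realType) (U V : Type) (D : set U) (p : U -> R)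
    (q : V -> R) (f : U -> V) : \bar R :=
  ereal_sup [set (q (f x))%:E | x in [set x | D x /\ p x <= 1]].

Section banach_spaces.
Variables (R : realType) (s : scalar_kind).
Local Notation K := (scalar_field R s).

(* Only the values of Q on Y matter. *)
Definition quotient_mapping (X Z : completeNormedModType K) (Y : set X)
    (Q : X -> Z) : Prop :=
  [/\ linear_on Y Q,
      (opnorm Y (@nrm R s X) (@nrm R s Z) Q < +oo)%E,
      Q @` Y = setT
    & forall z : Z, nrm z = inf [set nrm y | y in [set y | Y y /\ Q y = z]]].

Definition quotient_kernel (X Z : completeNormedModType K) (Y : set X) (Q : X -> Z) :
    set X := [set y | Y y /\ Q y = 0].

Definition sum_pair_norm (X V : completeNormedModType K) (p : X * V) : R :=
  nrm p.1 + nrm p.2.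

(* The product type is used only as a vector space: its library norm is the
   maximum norm. *)
Definition isometric_to_sum (A X V : completeNormedModType K) : Prop :=
  exists f : {linear (X * V)%type -> A},
    bijective f /\ forall p : X * V, nrm (f p) = sum_pair_norm p.

Section subspaces.
Variables (Z B : completeNormedModType K) (S : set B).

Definition projection_onto (p : {linear B -> B}) : Prop :=
  (forall x, S (p x)) /\ (forall x, S x -> p x = x).

Definition complemented : Prop :=
  exists p : {linear B -> B}, projection_onto p /\
    (opnorm setT (@nrm R s B) (@nrm R s B) p < +oo)%E.

Definition complemented_by (lam : R) : Prop :=
  exists p : {linear B -> B}, projection_onto p /\
    (opnorm setT (@nrm R s B) (@nrm R s B) p <= lam%:E)%E.

(* J is an isomorphism of Z onto S; G is its inverse (junk outside S). *)
Definition isomorphism_onto (J : {linear Z -> B}) (G : B -> Z) : Prop :=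
  [/\ forall z, S (J z),
      forall z, G (J z) = z,
      forall x, S x -> J (G x) = x,
      (opnorm setT (@nrm R s Z) (@nrm R s B) J < +oo)%E
    & (opnorm S (@nrm R s B) (@nrm R s Z) G < +oo)%E].

Definition isomorphic_onto : Prop :=
  exists (J : {linear Z -> B}) (G : B -> Z), isomorphism_onto J G.

Definition isomorphic_onto_by (lam : R) : Prop :=
  exists (J : {linear Z -> B}) (G : B -> Z), isomorphism_onto J G /\
    (opnorm setT (@nrm R s Z) (@nrm R s B) J *
     opnorm S (@nrm R s B) (@nrm R s Z) G <= lam%:E)%E.

End subspaces.

(* A Banach space continuously embedded in the topological vector space U.
   As a subset of U it is [range (emb A)]. *)
Record embedded (U : topologicalLmodType K) := Embedded {
  carrier : completeNormedModType K;
  emb : {linear carrier -> U};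
  emb_inj : injective emb;
  emb_cont : continuous emb
}.

Definition subspace_of (U : topologicalLmodType K) (A : embedded U) : set U :=
  range (emb A).

(* The norm of A transported to U; meaningful on [subspace_of A] only. *)
Definition norm_in (U : topologicalLmodType K) (A : embedded U) (u : U) : R :=
  nrm (xget 0 [set a : carrier A | emb A a = u]).

(* ||T||_{A -> B} *)
Definition opnorm_in (U V : topologicalLmodType K) (A : embedded U)
    (B : embedded V) (T : U -> V) : \bar R :=
  opnorm (subspace_of A) (norm_in A) (norm_in B) T.

Record couple := Couple {
  ambient : topologicalLmodType K;
  ambient_hausdorff : hausdorff_space ambient;
  side0 : embedded ambient;
  side1 : embedded ambient
}.

Definition sum_space (A : couple) : set (ambient A) :=
  [set x | exists x0 x1,
     [/\ subspace_of (side0 A) x0, subspace_of (side1 A) x1 & x0 + x1 = x]].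
Arguments sum_space A _ : clear implicits.

Definition sum_norm (A : couple) (x : ambient A) : R :=
  inf [set r | exists x0 x1,
     [/\ subspace_of (side0 A) x0, subspace_of (side1 A) x1, x0 + x1 = x
       & r = norm_in (side0 A) x0 + norm_in (side1 A) x1]].

Definition cap_space (A : couple) : set (ambient A) :=
  subspace_of (side0 A) `&` subspace_of (side1 A).
Arguments cap_space A _ : clear implicits.

Definition cap_norm (A : couple) (x : ambient A) : R :=
  Num.max (norm_in (side0 A) x) (norm_in (side1 A) x).

(* T is a function on the ambient space of which only the restriction to
   A_0 + A_1 matters. *)
Definition couple_map (A B : couple) (T : ambient A -> ambient B) : Prop :=
  [/\ linear_on (sum_space A) T,
      T @` subspace_of (side0 A) `<=` subspace_of (side0 B),
      T @` subspace_of (side1 A) `<=` subspace_of (side1 B),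
      (opnorm_in (side0 A) (side0 B) T < +oo)%E
    & (opnorm_in (side1 A) (side1 B) T < +oo)%E].

Definition norm_bounds (I : forall A : couple, embedded (ambient A)) (c : R) :
    Prop :=
  forall A : couple,
    (forall x, subspace_of (I A) x -> c^-1 * sum_norm x <= norm_in (I A) x) /\
    (forall x, cap_space A x -> norm_in (I A) x <= c * cap_norm x).

(* The functor sends a map of couples T to its restriction to A_I, so that it
   is determined by its action on couples. *)
Record interp_method := InterpMethod {
  interp :> forall A : couple, embedded (ambient A);
  interp_cap : forall A : couple, cap_space A `<=` subspace_of (interp A);
  interp_sum : forall A : couple, subspace_of (interp A) `<=` sum_space A;
  interp_bounds : exists c : R, 0 < c /\ norm_bounds interp c;
  interp_map : forall (A B : couple) (T : ambient A -> ambient B),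
    couple_map T ->
    T @` subspace_of (interp A) `<=` subspace_of (interp B) /\
    (opnorm_in (interp A) (interp B) T < +oo)%E
}.

Definition exponential_bound (I : interp_method) (theta c : R) : Prop :=
  forall (A B : couple) (T : ambient A -> ambient B), couple_map T ->
    (opnorm_in (I A) (I B) T <=
     c%:E * (poweR (opnorm_in (side0 A) (side0 B) T) (1 - theta)%R *
             poweR (opnorm_in (side1 A) (side1 B) T) theta))%E.

Definition exponential (I : interp_method) (theta : R) : Prop :=
  0 < theta < 1 /\ exists c : R, 0 < c /\ exponential_bound I theta c.

Definition exact_exponential (I : interp_method) (theta : R) : Prop :=
  [/\ exponential I theta, norm_bounds I 1 & exponential_bound I theta 1].

End banach_spaces.

Arguments sum_space {R s} A _.
Arguments cap_space {R s} A _.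

(* Main.v *)
Require Import Defs.
From HB Require Import structures.
From mathcomp Require Import all_boot all_order all_algebra.
From mathcomp Require Import all_classical all_reals all_analysis.
From mathcomp Require Import complex ring lra.

Set Implicit Arguments.
Unset Strict Implicit.
Unset Printing Implicit Defensive.

Import Order.TTheory GRing.Theory Num.Theory.
Import numFieldNormedType.Exports.

Local Open Scope classical_set_scope.
Local Open Scope ring_scope.

(** An exponential method I is controlled by two elementary estimates.  An
    element x common to A_0 and A_1 has norm at most a constant times
    |x|_0^(1-theta) |x|_1^theta in A_I (interp_common_element: compose with
    rank-one maps from a couple (V, V)).  A couple map that vanishes on one side
    vanishes on A_I (interp_vanishing: the exponential inequality bounds it
    by 0).  It remains to embed X_0 + V_0 and X_1 + V_1 in a common space so that
    these two facts single out Z.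

    Let N_i be the kernel of Q_i.  Take operators S : X_0 x X_1 -> V_1 with kernel
    {(x, x') in Y_0 x Y_1 : Q_0 x + Q_1 x' = 0}, T_1 : X_0 -> V_1 injective on N_0
    and T_0 : X_1 -> V_0 injective on N_1, and send
      (x, v) in A_0 to (S (x, 0), T_1 x, v),
      (x', v') in A_1 to (S (0, x'), v', T_0 x').
    The elements common to A_0 and A_1 then correspond to the pairs (y, y') in
    Y_0 x Y_1 with Q_0 y = Q_1 y': the spaces Y_0 and Y_1 are glued along Z, while
    N_0 is hidden in V_1 and N_1 in V_0.

    Projection.  If w is the image of (x, v) plus that of (x', v'), then x modulo
    Y_0 and x' modulo Y_1 depend only on w, and each vanishes on one side of the
    couple.  Hence on A_I every decomposition has x in Y_0 and x' in Y_1
    (interp_decomposition), P w = Q_0 x + Q_1 x' makes sense, and its norm is at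
    most the norm of w in A_0 + A_1 (projection_le).

    Section.  Put E z = (S (y, 0), 0, 0) for any y in Y_0 over z; this depends only
    on z, and linearly.  Lifting z to y in Y_0 and y' in Y_1 of almost the same
    norm gives the common element (S (y, 0), T_1 y, T_0 y'), of norm close to |z|
    when T_0 and T_1 are small.  The excess (0, T_1 y, 0) must be shown small in
    A_I, although y is not in N_0.  This is where T_1 is chosen with care
    (operator_injective_on): T_1 = sum_j lam_j phi_j(.) v_j where the phi_j are
    biorthogonal to vectors k_j of N_0, so that T_1 y is the sum of the
    T_1 (phi_j(y) k_j), whose A_I-norms are at most
    |phi_j(y) k_j|^(1-theta) |T_1 (phi_j(y) k_j)|^theta, hence summable if the lam_j
    decrease so fast that all their positive powers beat the norms of the phi_j.
    The other excess (0, 0, T_0 y') is treated in the same way (section_le).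

    The operators S, T_0, T_1 exist because separability yields countably many
    functionals that detect a closed subspace (separating_functionals, from
    Hahn-Banach), Gram-Schmidt makes them biorthogonal to vectors of N_i
    (biorthogonalize), and V_0, V_1 contain infinite biorthogonal sequences to
    serve as v_j (infinite_dim_biorthogonal). *)

(** * Scalars and norms *)

Section scalars.
Variables (R : realType) (s : scalar_kind).
Local Notation K := (scalar_field R s).

Definition of_real : R -> K :=
  match s return R -> scalar_field R s with
  | RealScalars => fun r => r
  | ComplexScalars => fun r => (r%:C)%C
  end.

(** `|a| takes its values in the scalar field itself; this is the same number read
    in R, as nrm is for vectors. *)
Definition modulus (a : K) : R := scalar_re `|a|.

Lemma of_realD r t : of_real (r + t) = of_real r + of_real t.
Proof. by rewrite /of_real; case: s => //=; rewrite rmorphD. Qed.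
Lemma of_realM r t : of_real (r * t) = of_real r * of_real t.
Proof. by rewrite /of_real; case: s => //=; rewrite rmorphM. Qed.
Lemma of_real1 : of_real 1 = 1.
Proof. by rewrite /of_real; case: s. Qed.
Lemma of_real0 : of_real 0 = 0.
Proof. by rewrite /of_real; case: s. Qed.
Lemma of_realN r : of_real (- r) = - of_real r.
Proof. by apply/eqP; rewrite -addr_eq0 -of_realD addNr of_real0. Qed.
Lemma re_of_real r : scalar_re (of_real r) = r.
Proof. by rewrite /of_real /scalar_re; case: s. Qed.
Lemma reD (a b : K) : scalar_re (a + b) = scalar_re a + scalar_re b.
Proof. by move: a b; rewrite /scalar_re /=; case: s => //= -[? ?] [? ?]. Qed.
Lemma reN (a : K) : scalar_re (- a) = - scalar_re a.
Proof. by move: a; rewrite /scalar_re /=; case: s => //= -[]. Qed.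
Lemma of_real_re (a : K) : 0 <= a -> a = of_real (scalar_re a).
Proof.
move: a; rewrite /scalar_re /of_real /=; case: s => //= -[a b].
by rewrite lecE /= => /andP[/eqP -> _].
Qed.
Lemma ge0_re (a : K) : 0 <= a -> 0 <= scalar_re a.
Proof.
by move: a; rewrite /scalar_re /=; case: s => //= -[a b]; rewrite lecE => /andP[].
Qed.
Lemma ler_re (a b : K) : a <= b -> scalar_re a <= scalar_re b.
Proof. by rewrite -subr_ge0 => /ge0_re; rewrite reD reN subr_ge0. Qed.
Lemma ler_of_real r t : (of_real r <= of_real t) = (r <= t).
Proof. by rewrite /of_real; case: s => //=; rewrite lecR. Qed.
Lemma ltr_of_real r t : (of_real r < of_real t) = (r < t).
Proof. by rewrite /of_real; case: s => //=; rewrite ltcR. Qed.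
Lemma of_real_gt0 r : 0 < r -> 0 < of_real r.
Proof. by move=> r0; rewrite -of_real0 ltr_of_real. Qed.
Lemma of_real_inj : injective of_real.
Proof. exact: can_inj re_of_real. Qed.

Lemma norm_modulus (a : K) : `|a| = of_real (modulus a).
Proof. by rewrite [LHS]of_real_re. Qed.
Lemma modulus_ge0 (a : K) : 0 <= modulus a.
Proof. exact: ge0_re. Qed.
Lemma modulusM (a b : K) : modulus (a * b) = modulus a * modulus b.
Proof. by apply: of_real_inj; rewrite of_realM -!norm_modulus normrM. Qed.
Lemma modulusD (a b : K) : modulus (a + b) <= modulus a + modulus b.
Proof. by rewrite -ler_of_real of_realD -!norm_modulus ler_normD. Qed.
Lemma modulusN (a : K) : modulus (- a) = modulus a.
Proof. by rewrite /modulus normrN. Qed.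
Lemma modulus0 : modulus 0 = 0.
Proof. by apply: of_real_inj; rewrite -norm_modulus normr0 of_real0. Qed.
Lemma modulus1 : modulus 1 = 1.
Proof. by apply: of_real_inj; rewrite -norm_modulus normr1 of_real1. Qed.
Lemma modulus_eq0 (a : K) : modulus a = 0 -> a = 0.
Proof. by move=> a0; apply/eqP; rewrite -normr_eq0 norm_modulus a0 of_real0. Qed.
Lemma modulus_of_real r : modulus (of_real r) = `|r|.
Proof.
apply: of_real_inj; rewrite -norm_modulus.
have [r0|/ltW r0] := leP 0 r.
  by rewrite !ger0_norm // -of_real0 ler_of_real.
by rewrite !ler0_norm ?of_realN // -of_real0 ler_of_real.
Qed.
Lemma re_le_modulus (a : K) : scalar_re a <= modulus a.
Proof.
move: a; rewrite /modulus /scalar_re /=; case: s => a; first exact: ler_norm.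
apply: le_trans (ler_norm _) _.
by have := normc_ge_Re a; rewrite lecE => /andP[].
Qed.

(** Rotating a scalar onto the nonnegative half-line is the device that turns
    bounds on real parts into bounds on moduli. *)
Lemma phase (a : K) : exists w : K, modulus w = 1 /\ w * a = of_real (modulus a).
Proof.
have [->|a0] := eqVneq a 0.
  by exists 1; rewrite modulus1 mulr0 modulus0 of_real0.
exists (`|a| / a); split.
  by apply: of_real_inj; rewrite -norm_modulus normrM normfV normr_id divff ?normr_eq0// of_real1.
by rewrite divfK// norm_modulus.
Qed.
End scalars.

Section norms.
Variables (R : realType) (s : scalar_kind).
Local Notation K := (scalar_field R s).
Variable X : normedModType K.
Implicit Types x y : X.

Lemma norm_nrm x : `|x| = of_real s (nrm x).
Proof. by rewrite [LHS]of_real_re. Qed.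
Lemma nrm_ge0 x : 0 <= nrm x.
Proof. exact: ge0_re. Qed.
Lemma nrmD x y : nrm (x + y) <= nrm x + nrm y.
Proof. by rewrite -(@ler_of_real R s) of_realD -!norm_nrm ler_normD. Qed.
Lemma nrmN x : nrm (- x) = nrm x.
Proof. by rewrite /nrm normrN. Qed.
Lemma nrmB x y : nrm (x - y) <= nrm x + nrm y.
Proof. by rewrite -(nrmN y) nrmD. Qed.
Lemma nrm_distC x y : nrm (x - y) = nrm (y - x).
Proof. by rewrite -nrmN opprB. Qed.
Lemma nrmZ (a : K) x : nrm (a *: x) = modulus a * nrm x.
Proof. by apply: (@of_real_inj R s); rewrite of_realM -norm_modulus -!norm_nrm normrZ. Qed.
Lemma nrm0 : nrm (0 : X) = 0.
Proof. by apply: (@of_real_inj R s); rewrite -norm_nrm normr0 of_real0. Qed.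
Lemma nrm_eq0 x : nrm x = 0 -> x = 0.
Proof. by move=> x0; apply/eqP; rewrite -normr_eq0 norm_nrm x0 of_real0. Qed.
Lemma nrm_gt0 x : x <> 0 -> 0 < nrm x.
Proof. by move=> x0; rewrite lt_neqAle nrm_ge0 andbT; apply/eqP => /esym/nrm_eq0. Qed.
Lemma nrm_unit x : 0 < nrm x -> nrm (of_real s (nrm x)^-1 *: x) = 1.
Proof. by move=> x0; rewrite nrmZ modulus_of_real ger0_norm ?invr_ge0 ?ltW// mulVf ?gt_eqF. Qed.
Lemma nrm_sum n (u : nat -> X) :
  nrm (\sum_(i < n) u i) <= \sum_(i < n) nrm (u i).
Proof.
elim: n => [|n IH]; first by rewrite !big_ord0 nrm0.
by rewrite !big_ord_recr /= (le_trans (nrmD _ _))// lerD2r.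
Qed.
Lemma nrm_le0 x : nrm x <= 0 -> x = 0.
Proof. by move=> x0; apply: nrm_eq0; apply/eqP; rewrite eq_le x0 nrm_ge0. Qed.

Lemma lt_normP (e : K) x : 0 < e -> (`|x| < e) = (nrm x < scalar_re e).
Proof. by move=> e0; rewrite norm_nrm {1}(of_real_re (ltW e0)) ltr_of_real. Qed.
Lemma re_gt0 (e : K) : 0 < e -> 0 < scalar_re e.
Proof. by move=> e0; rewrite -(@ltr_of_real R s) of_real0 -of_real_re// ltW. Qed.

Lemma nbhs_nrmP x (A : set X) :
  nbhs x A <-> exists2 e : R, 0 < e & forall y, nrm (x - y) < e -> A y.
Proof.
split.
  move=> /nbhs_ballP[e e0 eA]; exists (scalar_re e); first exact: re_gt0.
  by move=> y xy; apply: eA; rewrite -ball_normE /= lt_normP.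
move=> [e e0 eA]; apply/nbhs_ballP; exists (of_real s e); first exact: of_real_gt0.
by move=> y; rewrite -ball_normE /= norm_nrm ltr_of_real; exact: eA.
Qed.

Lemma closed_nrm (Y : set X) x : closed Y ->
  (forall e, 0 < e -> exists2 y, Y y & nrm (x - y) < e) -> Y x.
Proof.
move=> cY xY; apply: cY => B /nbhs_nrmP[e e0 eB].
by have [y Yy xy] := xY _ e0; exists y; split => //; apply: eB.
Qed.

Lemma nrm_closed (Y : set X) :
  (forall x, (forall e, 0 < e -> exists2 y, Y y & nrm (x - y) < e) -> Y x) -> closed Y.
Proof.
move=> Ycl x xY; apply: Ycl => e e0.
by have [|y [Yy xy]] := xY [set y | nrm (x - y) < e]; [apply/nbhs_nrmP; exists e | exists y].
Qed.

Definition dense_seq (u : nat -> X) : Prop :=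
  forall x e, 0 < e -> exists n, nrm (x - u n) < e.

Lemma separable_dense_seq : separable_space X -> exists u, dense_seq u.
Proof.
move=> [S [cS dS]].
have dS' x e : 0 < e -> exists2 y, S y & nrm (x - y) < e.
  move=> e0; have := dS (ball x (of_real s e)); case.
  - exists x; exact/ballxx/of_real_gt0.
  - exact: ball_open.
  by move=> y [+ Sy]; rewrite -ball_normE /= norm_nrm ltr_of_real => xy; exists y.
have [f fS] := elimT pcard_surjP cS.
exists f => x e e0; have [y Sy xy] := dS' x e e0.
by have [n _ fn] := fS y Sy; exists n; rewrite fn.
Qed.

Definition nrm_cvg (u : nat -> X) (x : X) : Prop :=
  forall e, 0 < e -> exists N, forall n, (N <= n)%N -> nrm (u n - x) < e.

Lemma nrm_cvg_cvg (u : nat -> X) x : nrm_cvg u x -> u @ \oo --> x.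
Proof.
move=> ux A /nbhs_nrmP[e e0 eA]; have [N uN] := ux _ e0.
by exists N => // n /= Nn; apply: eA; rewrite nrm_distC; apply: uN.
Qed.

Lemma nrm_cvg_le (u : nat -> X) x C : nrm_cvg u x -> (forall n, nrm (u n) <= C) -> nrm x <= C.
Proof.
move=> ux uC; apply/ler_addgt0Pr => e e0; have [N /(_ _ (leqnn N)) uN] := ux _ e0.
rewrite -(subrK (u N) x) addrC (le_trans (nrmD _ _))// lerD//.
by rewrite nrm_distC ltW.
Qed.

Lemma nrm_cvg_uniq (u : nat -> X) x y : nrm_cvg u x -> nrm_cvg u y -> x = y.
Proof.
move=> /nrm_cvg_cvg ux /nrm_cvg_cvg uy.
exact: (cvg_unique (@norm_hausdorff _ _) ux uy).
Qed.

End norms.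

Lemma bounded_linear_cont (R : realType) (s : scalar_kind)
    (X Y : normedModType (scalar_field R s)) (f : X -> Y) (C : R) :
  (forall x y, f (x - y) = f x - f y) -> (forall x, nrm (f x) <= C * nrm x) ->
  continuous f.
Proof.
move=> fB fC x A /nbhs_nrmP[e e0 eA].
have C0 : 0 < `|C| + 1 by rewrite ltr_wpDl.
apply/nbhs_nrmP; exists (e / (`|C| + 1)); first by rewrite divr_gt0.
move=> y xy /=; apply: eA; rewrite -fB (le_lt_trans (fC _))//.
rewrite ltr_pdivlMr// in xy; apply: le_lt_trans xy; rewrite mulrC ler_wpM2l ?nrm_ge0//.
by rewrite (le_trans (ler_norm _))// lerDl.
Qed.

Section products.
Variables (R : realType) (s : scalar_kind).
Local Notation K := (scalar_field R s).
Variables X V : normedModType K.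

Lemma nrm_pairl (x : X) : nrm ((x, 0) : X * V) = nrm x.
Proof. by rewrite /nrm prod_normE /= normr0 max_l. Qed.
Lemma nrm_pairr (v : V) : nrm ((0, v) : X * V) = nrm v.
Proof. by rewrite /nrm prod_normE /= normr0 max_r. Qed.
Lemma nrm_pair_le (x : X) (v : V) : nrm ((x, v) : X * V) <= nrm x + nrm v.
Proof.
rewrite -nrm_pairl -nrm_pairr; apply: le_trans (nrmD _ _).
by rewrite -[X in _ <= nrm X]/(x + 0, 0 + v) addr0 add0r.
Qed.
Lemma nrm_pair_ge (x : X) (v : V) : nrm x <= nrm (x, v) /\ nrm v <= nrm (x, v).
Proof.
by split; apply: ler_re; rewrite prod_normE /= comparable_le_max ?lexx ?orbT//;
  apply: real_comparable; rewrite normr_real.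
Qed.

Lemma dense_seq_pair : (exists u, @dense_seq R s X u) -> (exists w, @dense_seq R s V w) ->
  exists u, @dense_seq R s (X * V)%type u.
Proof.
move=> [u ud] [w wd].
exists (fun n => if unpickle n is Some (i, j) then (u i, w j) else 0) => -[x v] e e0.
have [i xi] := ud x (e / 2) (divr_gt0 e0 (ltr0Sn _ _)).
have [j vj] := wd v (e / 2) (divr_gt0 e0 (ltr0Sn _ _)).
exists (pickle (i, j)); rewrite pickleK; apply: le_lt_trans (nrm_pair_le _ _) _.
by rewrite [e]splitr ltrD.
Qed.
End products.

Section completeness.
Variables (R : realType) (s : scalar_kind).
Local Notation K := (scalar_field R s).
Variable X : completeNormedModType K.

Lemma abs_series (u : nat -> X) (r : nat -> R) (C : R) :
  (forall j, nrm (u j) <= r j) -> (forall n, \sum_(j < n) r j <= C) ->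
  exists x, nrm_cvg (fun n => \sum_(j < n) u j) x /\ nrm x <= C.
Proof.
move=> ur rC; pose U n := \sum_(j < n) u j; pose S n := \sum_(j < n) r j.
have r0 j : 0 <= r j by apply: le_trans (ur j); exact: nrm_ge0.
have US m n : nrm (U (m + n)%N - U m) <= S (m + n)%N - S m.
  elim: n => [|n IH]; first by rewrite addn0 !subrr nrm0.
  rewrite addnS /U /S !big_ord_recr /= -!(addrAC _ (- _)) (le_trans (nrmD _ _))//.
  exact: lerD.
have hS : has_sup (range S).
  by split; [exists (S 0); exists 0 | exists C => _ [n _ <-]; exact: rC].
have tail e : 0 < e -> exists N, forall n, (N <= n)%N -> nrm (U n - U N) < e.
  move=> e0; have [_ [N _ <-] NS] := sup_adherent e0 hS.
  exists N => n /subnKC <-; apply: le_lt_trans (US _ _) _.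
  have Sn := sup_upper_bound hS (imageT S (N + (n - N))%N).
  by lra.
have : cvg (U @ \oo).
  apply: cauchy_cvg; apply: cauchy_exP => e e0.
  have [N UN] := tail _ (re_gt0 e0); exists (U N); exists N => // n /= Nn.
  by rewrite -ball_normE /= lt_normP// nrm_distC; apply: UN.
move=> /cvg_ex[x Ux].
have cU : nrm_cvg U x.
  move=> e e0; have := Ux [set y | nrm (x - y) < e]; case.
    by apply/nbhs_nrmP; exists e.
  by move=> N _ NU; exists N => n Nn; rewrite nrm_distC; exact: NU.
exists x; split=> //; apply: (nrm_cvg_le cU) => n.
apply: le_trans (rC n); apply: le_trans (nrm_sum _ _) _; exact: ler_sum.
Qed.
End completeness.

(** * The Hahn-Banach theorem *)

Section hahn_banach.
Variables (R : realType) (s : scalar_kind).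
Local Notation K := (scalar_field R s).
Variables (X : lmodType K) (p : X -> R) (x0 : X).
Hypothesis pD : forall x y, p (x + y) <= p x + p y.
Hypothesis pZ : forall a x, p (a *: x) = modulus a * p x.

Let rZ (r : R) (x : X) : X := of_real s r *: x.

Let p_ge0 x : 0 <= p x.
Proof.
have : p 0 <= p x + p (- x) by rewrite -(subrr x) pD.
by rewrite -(scale0r x) -scaleN1r !pZ modulus0 modulusN modulus1; lra.
Qed.

Let pZr r x : 0 <= r -> p (rZ r x) = r * p x.
Proof. by move=> r0; rewrite pZ modulus_of_real ger0_norm. Qed.

(* Graphs of the real-linear functionals, dominated by p, on subspaces through
   x0, with value p x0 there; the empty graph is allowed because it is the
   union of the empty chain. *)
Let admissible (G : set (X * R)) : Prop :=
  [/\ forall r x a y b, G (x, a) -> G (y, b) -> G (rZ r x + y, r * a + b),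
      forall x a, G (x, a) -> a <= p x
    & G !=set0 -> G (x0, p x0)].

Let rZ0 x : rZ 0 x = 0. Proof. by rewrite /rZ of_real0 scale0r. Qed.
Let rZ1 x : rZ 1 x = x. Proof. by rewrite /rZ of_real1 scale1r. Qed.
Let rZM r t x : rZ r (rZ t x) = rZ (r * t) x.
Proof. by rewrite /rZ scalerA of_realM. Qed.
Let rZDl r t x : rZ (r + t) x = rZ r x + rZ t x.
Proof. by rewrite /rZ of_realD scalerDl. Qed.
Let rZDr r x y : rZ r (x + y) = rZ r x + rZ r y.
Proof. exact: scalerDr. Qed.

Let maximal_admissible : exists G, [/\ admissible G, G (x0, p x0) &
  forall H, G `<=` H -> admissible H -> H `<=` G].
Proof.
have [|G [aG Gmax]] := @Zorn_bigcup (X * R)%type admissible.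
  move=> F Fa Ft; split.
  - move=> r x a y b [G FG Gx] [H FH Hy].
    have [GH|HG] := Ft _ _ FG FH.
      by exists H => //; have [+ _ _] := Fa _ FH; apply => //; exact: GH.
    by exists G => //; have [+ _ _] := Fa _ FG; apply => //; exact: HG.
  - by move=> x a [G FG Gx]; have [_ + _] := Fa _ FG; apply.
  - move=> [z [G FG Gz]]; exists G => //; have [_ _] := Fa _ FG; apply.
    by exists z.
have Gmax' H : G `<=` H -> admissible H -> H `<=` G.
  by move=> GH aH; apply: contrapT => HG; apply: (Gmax H).
exists G; split=> //.
have [[z Gz]|/set0P/negP/negPn/eqP G0] := pselect (G !=set0).
  by have [_ _] := aG; apply; exists z.
pose L := [set z : X * R | exists t, z = (rZ t x0, t * p x0)].
have Lx0 : L (x0, p x0) by exists 1; rewrite rZ1 mul1r.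
have aL : admissible L.
  split=> //.
  - move=> r x a y b [t [-> ->]] [t' [-> ->]]; exists (r * t + t').
    by rewrite rZM rZDl mulrDl mulrA.
  - move=> x a [t [-> ->]]; by rewrite pZ modulus_of_real ler_wpM2r ?p_ge0 ?ler_norm.
by apply: (Gmax' L) => //; rewrite G0; exact: sub0set.
Qed.

(** Real scalars act through their image in K, so that one extension argument
    serves real and complex spaces. *)
Let real_hahn_banach : exists u : X -> R,
  [/\ forall x y, u (x + y) = u x + u y, forall r x, u (rZ r x) = r * u x,
      forall x, u x <= p x & u x0 = p x0].
Proof.
have [G [[Glin Gdom _] Gx0 Gmax]] := maximal_admissible.
have G00 : G (0, 0).
  by have := Glin (-1) _ _ _ _ Gx0 Gx0; rewrite -{2}(rZ1 x0) -rZDl addNr rZ0 mulN1r addNr.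
have GZ r x a : G (x, a) -> G (rZ r x, r * a).
  by move=> Gx; have := Glin r _ _ _ _ Gx G00; rewrite !addr0.
have GD x a y b : G (x, a) -> G (y, b) -> G (x + y, a + b).
  by move=> Gx Gy; have := Glin 1 _ _ _ _ Gx Gy; rewrite rZ1 mul1r.
have GB x a y b : G (x, a) -> G (y, b) -> G (y - x, b - a).
  move=> Gx Gy; have := Glin (-1) _ _ _ _ Gx Gy.
  by rewrite /rZ of_realN of_real1 scaleN1r mulN1r addrC [X in G (_, X)]addrC.
have Guniq x a b : G (x, a) -> G (x, b) -> a = b.
  move=> Ga Gb; have p0 : p 0 = 0 by rewrite -(scale0r (0 : X)) pZ modulus0 mul0r.
  have := Gdom _ _ (GB _ _ _ _ Ga Gb); have := Gdom _ _ (GB _ _ _ _ Gb Ga).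
  by rewrite subrr p0; lra.
have Gtot x : exists a, G (x, a).
  have cross y b z d : G (y, b) -> G (z, d) -> b - p (y - x) <= p (z + x) - d.
    move=> Gy Gz; have := Gdom _ _ (GD _ _ _ _ Gy Gz).
    have := pD (y - x) (z + x); rewrite addrACA addNr addr0; lra.
  (* The value c at x must lie above all b - p (y - x) and below all p (y + x) - b. *)
  pose A := [set r | exists y b, G (y, b) /\ r = b - p (y - x)].
  have hA : has_sup A.
    split; first by exists (0 - p (0 - x)); exists 0, 0.
    by exists (p (0 + x) - 0) => _ [y [b [Gy ->]]]; exact: cross.
  pose c := sup A.
  have cl y b : G (y, b) -> b - p (y - x) <= c.
    by move=> Gy; apply: (sup_upper_bound hA); exists y, b.
  have cu y b : G (y, b) -> c <= p (y + x) - b.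
    move=> Gy; apply: ge_sup; first by have [] := hA.
    by move=> _ [z [d [Gz ->]]]; exact: cross.
  pose H := [set z | exists y b t, G (y, b) /\ z = (y + rZ t x, b + t * c)].
  have GH : G `<=` H.
    by move=> [y b] Gy; exists y, b, 0; rewrite rZ0 mul0r !addr0.
  have aH : admissible H.
    split.
    - move=> r _ _ _ _ [y [b [t [Gy [-> ->]]]]] [z [d [t' [Gz [-> ->]]]]].
      exists (rZ r y + z), (r * b + d), (r * t + t'); split; first exact: Glin.
      rewrite rZDr rZM rZDl; congr (_, _); first by rewrite addrACA.
      by ring.
    - move=> _ _ [y [b [t [Gy [-> ->]]]]].
      have [t0|t0|->] := ltgtP t 0.
      + (* y + t x = |t| (y / |t| - x) *)
        have := cl _ _ (GZ (- t)^-1 _ _ Gy).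
        have -> : y + rZ t x = rZ (- t) (rZ (- t)^-1 y - x).
          rewrite rZDr rZM mulfV ?oppr_eq0 ?lt_eqF// rZ1; congr (_ + _).
          by rewrite /rZ of_realN scalerN scaleNr opprK.
        rewrite pZr; last by rewrite oppr_ge0 ltW.
        move=> h.
        have : (- t) * ((- t)^-1 * b - p (rZ (- t)^-1 y - x)) <= (- t) * c.
          by rewrite ler_wpM2l// oppr_ge0 ltW.
        rewrite mulrBr mulrA mulfV ?oppr_eq0 ?lt_eqF// mul1r; lra.
      + have := cu _ _ (GZ t^-1 _ _ Gy).
        have -> : y + rZ t x = rZ t (rZ t^-1 y + x).
          by rewrite rZDr rZM mulfV ?gt_eqF// rZ1.
        rewrite pZr; last exact: ltW.
        move=> h.
        have : t * c <= t * (p (rZ t^-1 y + x) - t^-1 * b).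
          by rewrite ler_wpM2l// ltW.
        rewrite mulrBr mulrA mulfV ?gt_eqF// mul1r; lra.
      + by rewrite rZ0 mul0r !addr0; exact: Gdom.
    - by move=> _; exact: GH.
  exists c; apply: (Gmax H) => //; exists 0, 0, 1.
  by rewrite rZ1 mul1r !add0r.
pose u x := projT1 (cid (Gtot x)).
have Gu x : G (x, u x) by rewrite /u; case: cid.
exists u; split.
- by move=> x y; apply: Guniq (Gu _) _; exact: GD.
- by move=> r x; apply: Guniq (Gu _) _; exact: GZ.
- by move=> x; exact: Gdom.
- exact: Guniq (Gu _) _.
Qed.

Definition functional (f : X -> K) : Prop := forall a x y, f (a *: x + y) = a * f x + f y.

(* Over C the functional is f x = u x - i u (i x). *)
Let complexify (u : X -> R) : (forall x y, u (x + y) = u x + u y) ->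
  (forall r x, u (rZ r x) = r * u x) ->
  exists2 f : X -> K, functional f & forall x, scalar_re (f x) = u x.
Proof.
rewrite /rZ /functional; case: s X u => Y u uD uZ.
  by exists u => // a x y; rewrite uD uZ.
have uN x : u (- x) = - u x by rewrite -scaleN1r -(of_real1 R ComplexScalars) -of_realN uZ mulN1r.
exists (fun x => (u x +i* (- u ('i%C *: x)))%C) => // -[a b] x y.
have split_scalar : (a +i* b)%C = of_real ComplexScalars a + of_real ComplexScalars b * 'i%C.
  by rewrite /of_real; simpc.
have -> : u ('i%C *: ((a +i* b)%C *: x + y)) = a * u ('i%C *: x) - b * u x + u ('i%C *: y).
  rewrite scalerDr uD scalerA; congr (_ + _).
  have -> : 'i%C * (a +i* b)%C = of_real ComplexScalars a * 'i%C + of_real ComplexScalars (- b).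
    by rewrite /of_real; simpc.
  by rewrite scalerDl uD -scalerA !uZ mulNr.
rewrite split_scalar uD scalerDl uD -scalerA !uZ -split_scalar.
by simpc; congr (_ +i* _)%C; ring.
Qed.

(** A bound on the real part of f is a bound on its modulus: rotate f x. *)
Lemma hahn_banach : exists f : X -> K,
  [/\ functional f, forall x, modulus (f x) <= p x & modulus (f x0) = p x0].
Proof.
have [u [uD uZ up ux0]] := real_hahn_banach.
have [f fl fu] := complexify uD uZ.
have f0 : f 0 = 0.
  by have := fl (-1) 0 0; rewrite scaler0 addr0 mulN1r addNr.
have fp x : modulus (f x) <= p x.
  have [w [w1 wx]] := phase (f x).
  have : scalar_re (f (w *: x)) <= p (w *: x) by rewrite fu.
  by rewrite -[w *: x]addr0 fl f0 !addr0 wx re_of_real pZ w1 mul1r.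
exists f; split=> //; apply/eqP; rewrite eq_le fp -ux0 -fu; exact: re_le_modulus.
Qed.

End hahn_banach.

(** * Separating functionals and biorthogonal systems *)

Section functionals.
Variables (R : realType) (s : scalar_kind).
Local Notation K := (scalar_field R s).

Lemma functional0 (X : lmodType K) (f : X -> K) : functional f -> f 0 = 0.
Proof. by move=> fl; have := fl (-1) 0 0; rewrite scaler0 addr0 mulN1r addNr. Qed.
Lemma functionalD (X : lmodType K) (f : X -> K) x y : functional f -> f (x + y) = f x + f y.
Proof. by move=> fl; have := fl 1 x y; rewrite scale1r mul1r. Qed.
Lemma functionalZ (X : lmodType K) (f : X -> K) a x : functional f -> f (a *: x) = a * f x.
Proof. by move=> fl; have := fl a x 0; rewrite !addr0 functional0// addr0. Qed.
Lemma functionalB (X : lmodType K) (f : X -> K) x y : functional f -> f (x - y) = f x - f y.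
Proof. by move=> fl; rewrite functionalD// -scaleN1r functionalZ// mulN1r. Qed.
Lemma lfun_sum (X : lmodType K) (f : X -> K) n (u : nat -> X) :
  functional f -> f (\sum_(i < n) u i) = \sum_(i < n) f (u i).
Proof.
move=> fl; elim: n => [|n IH]; first by rewrite !big_ord0 functional0.
by rewrite !big_ord_recr /= functionalD// IH.
Qed.

Variable X : normedModType K.

Definition bounded_functional (f : X -> K) : Prop :=
  functional f /\ exists M, forall x, modulus (f x) <= M * nrm x.

Lemma bounded_functional0 : bounded_functional (fun=> 0).
Proof.
split; first by move=> a x y; rewrite mulr0 addr0.
by exists 0 => x; rewrite modulus0 mul0r.
Qed.

Lemma bounded_functionalM (c : K) f : bounded_functional f -> bounded_functional (fun x => c * f x).
Proof.
move=> [fl [M fM]]; split; first by move=> a x y; rewrite fl; ring.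
by exists (modulus c * M) => x; rewrite modulusM -mulrA ler_wpM2l// modulus_ge0.
Qed.

Lemma bounded_functionalD f g : bounded_functional f -> bounded_functional g -> bounded_functional (fun x => f x + g x).
Proof.
move=> [fl [M fM]] [gl [M' gM]]; split; first by move=> a x y; rewrite fl gl; ring.
by exists (M + M') => x; rewrite (le_trans (modulusD _ _))// mulrDl lerD.
Qed.

Lemma bounded_functional_sum n (f : nat -> X -> K) :
  (forall i, (i < n)%N -> bounded_functional (f i)) -> bounded_functional (fun x => \sum_(i < n) f i x).
Proof.
elim: n => [|n IH] fb.
  rewrite [X in bounded_functional X](_ : _ = fun=> 0); first exact: bounded_functional0.
  by apply/funext => x; rewrite big_ord0.
rewrite [X in bounded_functional X](_ : _ = fun x => \sum_(i < n) f i x + f n x); last first.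
  by apply/funext => x; rewrite big_ord_recr.
by apply: bounded_functionalD; [apply: IH => i /ltnW; apply: fb | apply: fb].
Qed.

Lemma norming (x : X) : exists f : X -> K,
  [/\ functional f, forall y, modulus (f y) <= nrm y & modulus (f x) = nrm x].
Proof. by apply: hahn_banach; [exact: nrmD | exact: nrmZ]. Qed.

End functionals.

Section separation.
Variables (R : realType) (s : scalar_kind).
Local Notation K := (scalar_field R s).
Variables (X : normedModType K) (G : set X).
Hypotheses (Glin : linear_subspace G) (Gclosed : closed G).

Definition dist (x : X) : R := inf [set nrm (x - g) | g in G].

Let hD x : has_inf [set nrm (x - g) | g in G].
Proof.
split; first by exists (nrm (x - 0)); exists 0 => //; case: Glin.
by exists 0 => _ [g _ <-]; exact: nrm_ge0.
Qed.

Lemma dist_le x g : G g -> dist x <= nrm (x - g).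
Proof. by move=> Gg; apply: (ge_inf (proj2 (hD x))); exists g. Qed.

Lemma dist_ge0 x : 0 <= dist x.
Proof. by apply: lb_le_inf (proj1 (hD x)) _ => _ [g _ <-]; exact: nrm_ge0. Qed.

Lemma dist_near x e : 0 < e -> exists2 g, G g & nrm (x - g) < dist x + e.
Proof. by move=> e0; have [_ [g Gg <-] xg] := inf_adherent e0 (hD x); exists g. Qed.

Lemma distD x y : dist (x + y) <= dist x + dist y.
Proof.
apply/ler_addgt0Pr => e e0; have e20 : 0 < e / 2 by rewrite divr_gt0.
have [g Gg xg] := dist_near x e20; have [h Gh yh] := dist_near y e20.
have Ggh : G (g + h) by have [_ /(_ 1 g h Gg Gh)] := Glin; rewrite scale1r.
have := dist_le (x + y) Ggh; have := nrmD (x - g) (y - h).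
by rewrite opprD addrACA; lra.
Qed.

Lemma distZ a x : dist (a *: x) = modulus a * dist x.
Proof.
have GZ b g : G g -> G (b *: g).
  by move=> Gg; have [G0 /(_ b g 0 Gg G0)] := Glin; rewrite addr0.
have le b y : dist (b *: y) <= modulus b * dist y.
  apply/ler_addgt0Pr => e e0; have b0 := modulus_ge0 b.
  have e20 : 0 < e / (modulus b + 1) by rewrite divr_gt0// ltr_wpDl.
  have [g Gg yg] := dist_near y e20.
  apply: le_trans (dist_le _ (GZ b _ Gg)) _; rewrite -scalerBr nrmZ.
  apply: (@le_trans _ _ (modulus b * (dist y + e / (modulus b + 1)))).
    by rewrite ler_wpM2l// ltW.
  rewrite mulrDr lerD2l mulrCA -[leRHS]mulr1 ler_wpM2l ?(ltW e0)//.
  by rewrite ler_pdivrMr ?ltr_wpDl// mul1r lerDl.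
apply/eqP; rewrite eq_le le /=; have [->|a0] := eqVneq a 0.
  by rewrite modulus0 mul0r dist_ge0.
have sa0 : 0 < modulus a.
  by rewrite lt_neqAle modulus_ge0 andbT; apply: contra a0 => /eqP/esym/modulus_eq0/eqP.
have := le a^-1 (a *: x); rewrite scalerA mulVf// scale1r => h.
have -> : dist (a *: x) = modulus a * (modulus a^-1 * dist (a *: x)).
  by rewrite mulrA -modulusM mulfV// modulus1 mul1r.
by rewrite ler_pM2l.
Qed.

Lemma dist_nrm x : dist x <= nrm x.
Proof. by rewrite -{2}(subr0 x) dist_le//; case: Glin. Qed.

Lemma dist_eq0 x : dist x <= 0 -> G x.
Proof.
move=> x0; apply: closed_nrm => // e e0; have [g Gg xg] := dist_near x e0.
by exists g => //; lra.
Qed.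

Lemma dist_in x : G x -> dist x <= 0.
Proof. by move=> Gx; rewrite -(nrm0 X) -(subrr x) dist_le. Qed.

(** For a dense sequence (u_n), let phi_n attain at u_n the distance to G, which is
    a seminorm: where all phi_n vanish, that distance is 0. *)
Lemma separating_functionals : (exists u, @dense_seq R s X u) -> exists phi : nat -> X -> K,
  (forall n, bounded_functional (phi n)) /\ forall x, G x <-> forall n, phi n x = 0.
Proof.
move=> [u ud].
pose good n (f : X -> K) := [/\ functional f, forall y, modulus (f y) <= dist y &
  modulus (f (u n)) = dist (u n)].
have [phi phiP] : exists phi : nat -> X -> K, forall n, good n (phi n).
  exists (fun n => projT1 (cid (hahn_banach (u n) distD distZ))) => n.
  by case: cid.
exists phi; split => [n|x].
  have [fl fM _] := phiP n; split=> //; exists 1 => x.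
  by rewrite mul1r (le_trans (fM x))// dist_nrm.
split=> [Gx n|x0].
  have [_ fM _] := phiP n; apply: modulus_eq0; apply/eqP.
  by rewrite eq_le modulus_ge0 (le_trans (fM x))// dist_in.
apply: dist_eq0; apply/ler_addgt0Pr => e e0; rewrite add0r.
have e20 : 0 < e / 2 by rewrite divr_gt0.
have [n xn] := ud x _ e20; have [fl fM fu] := phiP n.
have : dist (u n) <= nrm (x - u n).
  have -> : dist (u n) = modulus (phi n (u n - x)) by rewrite functionalB// x0 subr0.
  by rewrite (le_trans (fM _))// nrm_distC dist_nrm.
have := distD (x - u n) (u n); have := dist_nrm (x - u n); rewrite subrK; lra.
Qed.
End separation.

Section sequences.

(** Since good n only constrains the terms below n, a choice made at one step is
    never revised, and the successive choices form a sequence. *)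
Lemma recursive_choice (T : Type) (good : nat -> (nat -> T) -> Prop) (u0 : nat -> T) :
  (forall n u w, (forall i, (i < n)%N -> u i = w i) -> good n u -> good n w) ->
  good 0 u0 ->
  (forall n u, good n u -> exists x, good n.+1 (fun i => if i == n then x else u i)) ->
  exists u, forall n, good n u.
Proof.
move=> ext good0 step.
pose S n := {u | good n u}.
pose next n (st : S n) : S n.+1 :=
  let h := cid (step n (projT1 st) (projT2 st)) in
  exist (good n.+1) (fun i => if i == n then projT1 h else projT1 st i) (projT2 h).
pose st := fix st n : S n := if n is n'.+1 then next n' (st n') else exist (good 0) u0 good0.
have st_stable n m i : (i < n)%N -> projT1 (st (n + m)%N) i = projT1 (st n) i.
  move=> lin; elim: m => [|m IH]; first by rewrite addn0.
  by rewrite addnS /= ltn_eqF ?IH// ltn_addr.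
exists (fun i => projT1 (st i.+1) i) => n.
apply: (ext n (projT1 (st n))); last exact: projT2 (st n).
by move=> i lin; rewrite -(subnKC lin) st_stable.
Qed.

Variables (R : realType) (s : scalar_kind).
Local Notation K := (scalar_field R s).

Definition biorthogonal (V : normedModType K) (v : nat -> V) (f : nat -> V -> K) : Prop :=
  [/\ forall n, nrm (v n) = 1, forall n, bounded_functional (f n)
    & forall i j, f i (v j) = (i == j)%:R].

(** Common kernels of finitely many functionals are nonzero in infinite
    dimension, which leaves room for one more vector at each step. *)
Lemma infinite_dim_biorthogonal (V : normedModType K) :
  dimension [set: V] = None -> exists v f, @biorthogonal V v f.
Proof.
move=> Vinf.
pose good n (u : nat -> V * (V -> K)) := forall i, (i < n)%N ->
  [/\ nrm (u i).1 = 1, bounded_functional (u i).2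
    & forall j, (j < n)%N -> (u i).2 (u j).1 = (i == j)%:R].
have [||n u gu|u gu] := @recursive_choice _ good (fun=> (0, fun=> 0)).
- move=> n u w uw gu i lin; rewrite -uw//; have [ni bi fi] := gu i lin.
  by split=> // j ljn; rewrite -(uw j)// fi.
- by [].
- have [w [w0 fw]] : exists w, w <> 0 /\ forall i, (i < n)%N -> (u i).2 w = 0.
    apply: contrapT => none; move: Vinf; rewrite /dimension /dim_mod.
    case: pselect => // -[]; exists n, (fun i => (u i).1); split=> // x _.
    pose c := [ffun i : 'I_n => (u i).2 x].
    have f_comb (d : {ffun 'I_n -> K}) j : (j < n)%N ->
        (u j).2 (\sum_(i < n) d i *: (u i).1) = \sum_(i < n) d i * (j == i)%:R.
      move=> ljn; have [_ [fl _] fj] := gu j ljn.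
      rewrite (big_morph (u j).2 (id1 := 0) (op1 := +%R)).
      - by apply: eq_bigr => i _; rewrite functionalZ// fj.
      - by move=> y z; rewrite functionalD.
      - exact: functional0.
    have f_coef (d : {ffun 'I_n -> K}) (j : 'I_n) :
        (u j).2 (\sum_(i < n) d i *: (u i).1) = d j.
      rewrite f_comb// (bigD1 j)//= eqxx mulr1 big1 ?addr0// => i ij.
      by rewrite [j == i :> nat]eq_sym (negPf (ij : (i != j :> nat))) mulr0.
    exists c; split.
      apply: contrapT => nz; apply: none; eexists; split; first exact: nz.
      move=> i lin; have [_ [fl _] _] := gu i lin.
      by rewrite functionalB// (f_coef c (Ordinal lin)) ffunE subrr.
    move=> d /= /subr0_eq xd; apply/ffunP => i; rewrite ffunE xd; exact: f_coef.
  pose w1 := (of_real s (nrm w)^-1) *: w.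
  have nw : 0 < nrm w by exact: nrm_gt0.
  have nw1 : nrm w1 = 1 by exact: nrm_unit.
  have fw1 i : (i < n)%N -> (u i).2 w1 = 0.
    by move=> lin; have [_ [fl _] _] := gu i lin; rewrite functionalZ// fw// mulr0.
  have [f [fl fM fw1']] := norming w1.
  have f0 : f w1 != 0.
    by apply/eqP => f0; move: fw1'; rewrite f0 modulus0 nw1 => /esym/eqP; rewrite oner_eq0.
  pose g := fun x => (f w1)^-1 * (f x + \sum_(i < n) (- f (u i).1) * (u i).2 x).
  have gb : bounded_functional g.
    apply: bounded_functionalM; apply: bounded_functionalD.
      by split=> //; exists 1 => x; rewrite mul1r.
    apply: (@bounded_functional_sum _ _ _ n (fun i x => - f (u i).1 * (u i).2 x)) => i lin.
    by apply: bounded_functionalM; have [] := gu i lin.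
  have gw1 : g w1 = 1.
    by rewrite /g big1 ?addr0 ?mulVf// => i _; rewrite fw1// mulr0.
  have gu0 j : (j < n)%N -> g (u j).1 = 0.
    move=> ljn; rewrite /g (bigD1 (Ordinal ljn))//= big1 ?addr0.
      by have [_ _ ->//] := gu j ljn; rewrite eqxx mulr1 subrr mulr0.
    move=> i ij; have [_ _ ->//] := gu i (ltn_ord i).
    by rewrite (negPf (ij : (i != j :> nat))) mulr0.
  exists (w1, g) => i; rewrite ltnS leq_eqVlt => /predU1P[->|lin].
    rewrite eqxx; split=> // j; rewrite ltnS leq_eqVlt => /predU1P[->|ljn].
      by rewrite eqxx.
    by rewrite (ltn_eqF ljn) /= gu0// (gtn_eqF ljn).
  rewrite (ltn_eqF lin); have [ni bi fi] := gu i lin; split=> // j.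
  rewrite ltnS leq_eqVlt => /predU1P[->|ljn]; first by rewrite eqxx /= fw1// (ltn_eqF lin).
  by rewrite (ltn_eqF ljn) fi.
- exists (fun n => (u n).1), (fun n => (u n).2); split=> [n|n|i j].
  + by have [] := gu n.+1 n (leqnn _).
  + by have [] := gu n.+1 n (leqnn _).
  + have [_ _ ->//] := gu (maxn i j).+1 i (leq_maxl _ _ : (i < (maxn i j).+1)%N).
    exact: (leq_maxr _ _ : (j < (maxn i j).+1)%N).
Qed.

End sequences.

(** * Gram-Schmidt for functionals; fast weights *)

Section gram_schmidt.
Variables (R : realType) (s : scalar_kind).
Local Notation K := (scalar_field R s).
Variables (X : normedModType K) (N : set X) (psi : nat -> X -> K).
Hypotheses (Nlin : linear_subspace N) (psib : forall n, bounded_functional (psi n)).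

Let good n (u : nat -> X * (X -> K)) := forall i, (i < n)%N ->
  [/\ N (u i).1, nrm (u i).1 <= 1, bounded_functional (u i).2,
      (u i).2 (u i).1 = 1 \/ ((u i).1 = 0 /\ forall y, (u i).2 y = 0)
    & (forall j, (j < n)%N -> i != j -> (u i).2 (u j).1 = 0) /\
      (forall x, N x -> (forall j, (j <= i)%N -> (u j).2 x = 0) -> psi i x = 0)].

Let N_sum n (v : nat -> X) : (forall i, (i < n)%N -> N (v i)) -> N (\sum_(i < n) v i).
Proof.
elim: n => [|n IH] Nv; first by rewrite big_ord0; case: Nlin.
rewrite big_ord_recr /= -[X in N (X + _)]scale1r.
case: Nlin => _ Nl; apply: Nl; first by apply: IH => i /ltnW; exact: Nv.
exact: Nv.
Qed.

Let NZ a x : N x -> N (a *: x).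
Proof. by move=> Nx; have [N0 /(_ a x 0 Nx N0)] := Nlin; rewrite addr0. Qed.


Let step n u : good n u -> exists x, good n.+1 (fun i => if i == n then x else u i).
Proof.
move=> gu.
pose g x := psi n x + \sum_(i < n) (- psi n (u i).1) * (u i).2 x.
have gb : bounded_functional g.
  apply: bounded_functionalD => //.
  apply: (@bounded_functional_sum _ _ _ n (fun i x => - psi n (u i).1 * (u i).2 x)) => i lin.
  by apply: bounded_functionalM; have [] := gu i lin.
have gl := proj1 gb.
have gu0 j : (j < n)%N -> g (u j).1 = 0.
  move=> ljn; rewrite /g (bigD1 (Ordinal ljn))//= big1 ?addr0.
    have [_ _ _ [->|[-> f0]] _] := gu j ljn; first by rewrite mulr1 subrr.
    by rewrite f0 mulr0 addr0 functional0//; case: (psib n).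
  by move=> i ij; have [_ _ _ _ [->//]] := gu i (ltn_ord i); rewrite mulr0.
(* what a new pair (k, f) has to satisfy; g plays the part of psi n, since the
   two agree where the earlier functionals vanish *)
have extend k f : N k -> nrm k <= 1 -> bounded_functional f ->
    f k = 1 \/ (k = 0 /\ forall y, f y = 0) ->
    (forall j, (j < n)%N -> f (u j).1 = 0 /\ (u j).2 k = 0) ->
    (forall x, N x -> f x = 0 -> g x = 0) ->
    good n.+1 (fun i => if i == n then (k, f) else u i).
  move=> Nk k1 fb fk fu fg i; rewrite ltnS leq_eqVlt => /predU1P[->|lin].
    rewrite eqxx; split=> //; split => [j|x Nx fx].
      rewrite ltnS leq_eqVlt => /predU1P[->|ljn]; first by rewrite eqxx.
      by rewrite (ltn_eqF ljn) => _; have [] := fu j ljn.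
    have ux (j : 'I_n) : (u j).2 x = 0.
      by have := fx j (ltnW (ltn_ord j)); rewrite (ltn_eqF (ltn_ord j)).
    have := fg x Nx; have := fx n (leqnn n); rewrite eqxx => /= -> /(_ erefl).
    by rewrite /g big1 ?addr0// => j _; rewrite ux mulr0.
  rewrite (ltn_eqF lin); have [Ni ni bi di [oi pi]] := gu i lin; split=> //.
  split=> [j|x Nx ux].
    rewrite ltnS leq_eqVlt => /predU1P[->|ljn]; last by rewrite (ltn_eqF ljn); exact: oi.
    by rewrite eqxx; have [] := fu i lin.
  apply: pi => // j lji; have := ux j lji.
  by rewrite (ltn_eqF (leq_ltn_trans lji lin)).
have [g0|/existsNP[h /not_implyP[Nh gh]]] := pselect (forall x, N x -> g x = 0).
  exists (0, fun=> 0); apply: extend => //.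
  - by case: Nlin.
  - by rewrite nrm0 ler01.
  - exact: bounded_functional0.
  - by right.
  - by move=> j ljn; split=> //; have [_ _ [fl _] _ _] := gu j ljn; exact: functional0.
  - by move=> x Nx _; exact: g0.
pose k0 := h + \sum_(i < n) (- (u i).2 h) *: (u i).1.
have Nk0 : N k0.
  rewrite /k0 -[X in N (X + _)]scale1r; case: (Nlin) => _ Nl; apply: Nl => //.
  by apply: (N_sum (v := fun i => - (u i).2 h *: (u i).1)) => i lin; apply: NZ; have [] := gu i lin.
have gk0 : g k0 = g h.
  rewrite /k0 functionalD// (lfun_sum _ (fun i => - (u i).2 h *: (u i).1))//.
  by rewrite big1 ?addr0// => i _; rewrite functionalZ// gu0// mulr0.
have uk0 j : (j < n)%N -> (u j).2 k0 = 0.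
  move=> ljn; have [_ _ [fl _] dj [oj _]] := gu j ljn.
  rewrite /k0 functionalD// (lfun_sum _ (fun i => - (u i).2 h *: (u i).1))//.
  rewrite (bigD1 (Ordinal ljn))//= big1 ?addr0; last first.
    by move=> i ij; rewrite functionalZ// oj ?mulr0// eq_sym.
  rewrite functionalZ//; case: dj => [->|[_ f0]]; first by rewrite mulr1 subrr.
  by rewrite !f0 mulr0 addr0.
have nk0 : 0 < nrm k0.
  by apply: nrm_gt0 => k00; apply: gh; rewrite -gk0 k00 functional0.
pose k := of_real s (nrm k0)^-1 *: k0.
have gk : g k != 0.
  apply/eqP; rewrite /k functionalZ// gk0 => /eqP; rewrite mulf_eq0 => /orP[|/eqP//].
  by rewrite -(of_real0 R s) (inj_eq (@of_real_inj R s)) invr_eq0 gt_eqF.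
exists (k, fun x => (g k)^-1 * g x); apply: extend.
- exact: NZ.
- by rewrite nrm_unit.
- exact: bounded_functionalM.
- by left; rewrite mulVf.
- move=> j ljn; split; first by rewrite gu0// mulr0.
  by have [_ _ [fl _] _ _] := gu j ljn; rewrite functionalZ// uk0// mulr0.
- by move=> x Nx /eqP; rewrite mulf_eq0 invr_eq0 (negPf gk) => /eqP.
Qed.

(** Gram-Schmidt for functionals: subtracting from psi_n its values on the
    earlier vectors, and from the new vector its coordinates, keeps the system
    biorthogonal without shrinking the common kernel in N.  A functional that
    becomes null on N is recorded as the pair (0, 0). *)
Lemma biorthogonalize : exists (phi : nat -> X -> K) (k : nat -> X),
  [/\ forall n, bounded_functional (phi n), forall n, N (k n) /\ nrm (k n) <= 1,
      forall i j, i != j -> phi i (k j) = 0,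
      forall i, phi i (k i) = 1 \/ (k i = 0 /\ forall y, phi i y = 0)
    & forall x, N x -> (forall n, phi n x = 0) -> forall n, psi n x = 0].
Proof.
have [||u gu] := @recursive_choice _ good (fun=> (0, fun=> 0)) _ _ step.
- move=> n u w uw gu i lin; have [Ni ni bi di [oi pi]] := gu i lin.
  rewrite -uw//; split=> //; split=> [j ljn|x Nx wx]; first by rewrite -(uw j)//; exact: oi.
  by apply: pi => // j lji; rewrite uw ?wx// (leq_ltn_trans lji lin).
- by [].
exists (fun n => (u n).2), (fun n => (u n).1); split=> [n|n|i j ij|i|x Nx ux n].
- by have [] := gu n.+1 n (leqnn _).
- by have [] := gu n.+1 n (leqnn _).
- have [_ _ _ _ [+ _]] := gu (maxn i j).+1 i (leq_maxl _ _ : (i < (maxn i j).+1)%N).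
  by apply => //; exact: (leq_maxr _ _ : (j < (maxn i j).+1)%N).
- by have [] := gu i.+1 i (leqnn _).
- by have [_ _ _ _ [_]] := gu n.+1 n (leqnn _); apply => // j _; exact: ux.
Qed.

End gram_schmidt.

Section series_operator.
Variables (R : realType) (s : scalar_kind).
Local Notation K := (scalar_field R s).

Lemma geometric_le (e : R) n : 0 <= e -> \sum_(j < n) e * 2^-1 ^+ j.+1 <= e.
Proof.
move=> e0; suff -> : \sum_(j < n) e * 2^-1 ^+ j.+1 = e * (1 - 2^-1 ^+ n).
  by rewrite ler_piMr// lerBlDr lerDl exprn_ge0// invr_ge0.
elim: n => [|n IH]; first by rewrite big_ord0 expr0 subrr mulr0.
by rewrite big_ord_recr /= IH exprS; field.
Qed.

(** With lam_j = (eta 2^-(j+1) / M_j)^(p+j), the power lam_j^tau is at most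
    eta 2^-(j+1) / M_j as soon as (p + j) tau >= 1: for all j if p >= 1/tau0 and
    tau >= tau0, and for all but finitely many j for any tau > 0. *)
Lemma fast_weights (M : nat -> R) (eta tau0 : R) : (forall j, 1 <= M j) ->
  0 < eta <= 1 -> 0 < tau0 ->
  exists lam : nat -> R, [/\ forall j, 0 < lam j,
    forall tau, tau0 <= tau -> forall n, \sum_(j < n) M j * lam j `^ tau <= eta
  & forall tau, 0 < tau -> exists C, forall n, \sum_(j < n) M j * lam j `^ tau <= C].
Proof.
move=> M1 /andP[eta0 eta1] tau00.
have M0 j : 0 < M j by exact: lt_le_trans (M1 j).
pose a j := eta * 2^-1 ^+ j.+1 / M j.
have a0 j : 0 < a j by rewrite divr_gt0// mulr_gt0// exprn_gt0// invr_gt0.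
have a1 j : a j <= 1.
  rewrite /a ler_pdivrMr// mul1r (le_trans _ (M1 j))// mulr_ile1//.
  - exact: ltW.
  - by rewrite exprn_ile1 ?invr_ge0// invf_le1// ler1n.
pose p := Num.bound (tau0^-1).
pose lam j := a j ^+ (p + j)%N.
have key tau j : 1 <= (p + j)%:R * tau -> M j * lam j `^ tau <= eta * 2^-1 ^+ j.+1.
  move=> h; rewrite [M j * _]mulrC -ler_pdivlMr// -/(a j) /lam -powR_mulrn ?(ltW (a0 j))// -powRrM.
  have : a j `^ ((p + j)%:R * tau) <= a j `^ 1 by apply: ger_powR; rewrite ?a0 ?a1.
  by rewrite powRr1 ?(ltW (a0 j)).
have lam1 j : 0 <= lam j <= 1.
  by have aj := ltW (a0 j); rewrite /lam exprn_ge0//= exprn_ile1.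
exists lam; split=> [j|tau tau0t n|tau t0].
- exact: exprn_gt0.
- apply: le_trans (geometric_le n (ltW eta0)); apply: ler_sum => j _; apply: key.
  have : tau0^-1 < p%:R by apply: archi_boundP; rewrite invr_ge0 ltW.
  rewrite -[tau0^-1]mul1r ltr_pdivrMr// => h; apply/ltW/(lt_le_trans h).
  by apply: ler_pM => //; [exact: ltW | rewrite ler_nat leq_addr].
pose J := Num.bound tau^-1.
exists (\sum_(j < J) M j + eta) => n.
have tail j : (J <= j)%N -> M j * lam j `^ tau <= eta * 2^-1 ^+ j.+1.
  move=> Jj; apply: key.
  have : tau^-1 < J%:R by apply: archi_boundP; rewrite invr_ge0 ltW.
  rewrite -[tau^-1]mul1r ltr_pdivrMr// => h; apply/ltW/(lt_le_trans h).
  by rewrite ler_wpM2r ?(ltW t0)// ler_nat (leq_trans Jj)// leq_addl.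
have half j : 0 <= eta * 2^-1 ^+ j.+1.
  by rewrite mulr_ge0 ?(ltW eta0)// exprn_ge0// invr_ge0.
suff split_sum m : \sum_(j < m) M j * lam j `^ tau <=
    \sum_(j < minn m J) M j + \sum_(j < m) eta * 2^-1 ^+ j.+1.
  apply: le_trans (split_sum n) _; rewrite lerD ?geometric_le ?(ltW eta0)//.
  move: (geq_minr n J); move: (minn n J) => m mJ; rewrite -(subnKC mJ) big_split_ord /= lerDl.
  by rewrite sumr_ge0// => j _; exact/ltW.
elim: m => [|m IH]; first by rewrite min0n !big_ord0 addr0.
rewrite !big_ord_recr /=; case: (leqP J m) => Jm.
  have := tail m Jm; move: IH.
  by rewrite (minn_idPr Jm) (minn_idPr (leqW Jm)); lra.
have : M m * lam m `^ tau <= M m.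
  have /andP[lam0 lam_le1] := lam1 m.
  have : lam m `^ tau <= 1 `^ tau.
    by apply: ge0_ler_powR; rewrite ?nnegrE ?ler01// (ltW t0).
  by rewrite powR1 => lam_tau; rewrite -[leRHS]mulr1 ler_wpM2l// ltW.
move: IH; rewrite (minn_idPl Jm) (minn_idPl (ltnW Jm)) big_ord_recr /=.
by have := half m; lra.
Qed.
End series_operator.

(** * Series operators *)

Section linear_maps.
Variables (K : pzRingType) (U V : lmodType K).

(** The proof is a parameter of the constant, so that the linear structure is
    attached to it and not to arbitrary functions. *)
Definition as_linear (f : U -> V) (f_linear : linear f) : U -> V := f.

HB.instance Definition _ (f : U -> V) (f_linear : linear f) :=
  GRing.isLinear.Build K U V *:%R (as_linear f_linear) f_linear.

Lemma linear_ex (f : U -> V) (f_linear : linear f) :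
  exists h : {linear U -> V}, forall x, h x = f x.
Proof. by exists (as_linear f_linear : {linear U -> V}). Qed.
End linear_maps.

Section series_operators.
Variables (R : realType) (s : scalar_kind).
Local Notation K := (scalar_field R s).

Lemma nrm_cvg_lin (X : normedModType K) (u w : nat -> X) x y (a : K) :
  nrm_cvg u x -> nrm_cvg w y -> nrm_cvg (fun n => a *: u n + w n) (a *: x + y).
Proof.
move=> ux wy e e0; have a1 : 0 < modulus a + 1 by rewrite ltr_wpDl ?modulus_ge0.
have [N uN] := ux (e / 2 / (modulus a + 1)) (divr_gt0 (divr_gt0 e0 (ltr0Sn _ _)) a1).
have [N' wN] := wy (e / 2) (divr_gt0 e0 (ltr0Sn _ _)).
exists (maxn N N') => n; rewrite geq_max => /andP[/uN un /wN wn].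
rewrite opprD addrACA -scalerBr. apply: le_lt_trans (nrmD _ _) _; rewrite nrmZ.
have : modulus a * nrm (u n - x) <= e / 2.
  apply: (@le_trans _ _ ((modulus a + 1) * nrm (u n - x))).
    by rewrite ler_wpM2r ?nrm_ge0// lerDl.
  by rewrite mulrC -ler_pdivlMr// ltW.
by move=> aun; rewrite [e]splitr; exact: ler_ltD aun wn.
Qed.

Lemma nrm_cvg_eventually (X : normedModType K) (u : nat -> X) x N :
  (forall n, (N <= n)%N -> u n = x) -> nrm_cvg u x.
Proof. by move=> ux e e0; exists N => n Nn; rewrite ux// subrr nrm0. Qed.

(** T x = sum_j lam_j phi_j(x) v_j; the biorthogonal f_j read the coefficients
    off T x, so that T forgets no phi_j. *)
Lemma series_operator (X : normedModType K) (V : completeNormedModType K)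
    (phi : nat -> X -> K) (v : nat -> V) (f : nat -> V -> K)
    (M lam : nat -> R) (eta : R) :
  biorthogonal v f -> (forall j, functional (phi j)) ->
  (forall j x, modulus (phi j x) <= M j * nrm x) ->
  (forall j, 0 < lam j) -> (forall n, \sum_(j < n) M j * lam j <= eta) ->
  exists T : {linear X -> V},
    [/\ forall x, nrm_cvg (fun n => \sum_(j < n) (of_real s (lam j) * phi j x) *: v j) (T x),
        forall x, nrm (T x) <= eta * nrm x
      & forall x, T x = 0 -> forall j, phi j x = 0].
Proof.
move=> [v1 fb fv] phil phiM lam0 Meta.
have bound (x : X) j : nrm ((of_real s (lam j) * phi j x) *: v j) <= M j * lam j * nrm x.
  rewrite nrmZ v1 mulr1 modulusM modulus_of_real gtr0_norm// mulrAC mulrC.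
  by rewrite ler_wpM2r ?(ltW (lam0 j)).
have total (x : X) n : \sum_(j < n) M j * lam j * nrm x <= eta * nrm x.
  by rewrite -mulr_suml ler_wpM2r ?nrm_ge0.
have Tex x := abs_series (bound x) (total x).
pose T x := projT1 (cid (Tex x)).
have Tconv x : nrm_cvg (fun n => \sum_(j < n) (of_real s (lam j) * phi j x) *: v j) (T x).
  by rewrite /T; case: cid => ? [].
have Tlin : linear T.
  move=> a x y; apply: nrm_cvg_uniq (Tconv _) _.
  rewrite [X in nrm_cvg X _](_ : _ = fun n => a *: (\sum_(j < n) (of_real s (lam j) * phi j x) *: v j)
    + \sum_(j < n) (of_real s (lam j) * phi j y) *: v j); first exact: nrm_cvg_lin.
  apply/funext => n; rewrite scaler_sumr -big_split /=; apply: eq_bigr => j _.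
  by rewrite phil scalerA -scalerDl; congr (_ *: _); ring.
have [T' T'E] := linear_ex Tlin.
exists T'; split=> [x|x|x Tx j]; rewrite ?T'E//.
  by rewrite /T; case: cid => ? [].
have [fjl [C fC]] := fb j.
have fpart n : (j < n)%N ->
    f j (\sum_(i < n) (of_real s (lam i) * phi i x) *: v i) = of_real s (lam j) * phi j x.
  move=> ljn; rewrite (lfun_sum _ (fun i => (of_real s (lam i) * phi i x) *: v i))//.
  rewrite (bigD1 (Ordinal ljn))//= big1 => [|i ij]; rewrite functionalZ// fv.
    by rewrite eqxx mulr1 addr0.
  by rewrite [j == i]eq_sym (negPf (ij : i != j :> nat)) mulr0.
suff : modulus (of_real s (lam j) * phi j x) <= 0.
  rewrite modulusM modulus_of_real gtr0_norm// pmulr_rle0// => h.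
  by apply: modulus_eq0; apply/eqP; rewrite eq_le h modulus_ge0.
apply/ler_addgt0Pr => e e0; rewrite add0r.
have C1 : 0 < `|C| + 1 by rewrite ltr_wpDl.
have [N] := Tconv x _ (divr_gt0 e0 C1).
move=> /(_ (maxn N j.+1) (leq_maxl _ _)); rewrite -T'E Tx subr0 ltr_pdivlMr// => /ltW.
apply: le_trans; rewrite -(fpart (maxn N j.+1) (leq_maxr _ _)) (le_trans (fC _))//.
by rewrite mulrC ler_wpM2l ?nrm_ge0// (le_trans (ler_norm _))// lerDl.
Qed.

Lemma bounded_functional_bound (X : normedModType K) (phi : nat -> X -> K) :
  (forall n, bounded_functional (phi n)) ->
  exists M : nat -> R, (forall n, 1 <= M n) /\ forall n x, modulus (phi n x) <= M n * nrm x.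
Proof.
move=> phib.
have bd n : exists m, 1 <= m /\ forall x, modulus (phi n x) <= m * nrm x.
  have [_ [m phim]] := phib n; exists (`|m| + 1); split; first by rewrite lerDr.
  move=> x; rewrite (le_trans (phim x))// ler_wpM2r ?nrm_ge0//.
  by rewrite (le_trans (ler_norm _))// lerDl.
by exists (fun n => projT1 (cid (bd n))); split=> n; case: cid => m [].
Qed.

Lemma operator_with_kernel (X : normedModType K) (V : completeNormedModType K) (G : set X) :
  (exists u, @dense_seq R s X u) -> linear_subspace G -> closed G -> dimension [set: V] = None ->
  exists (T : {linear X -> V}) (C : R),
    (forall x, nrm (T x) <= C * nrm x) /\ forall x, T x = 0 <-> G x.
Proof.
move=> Xsep Glin Gcl Vinf.
have [phi [phib phiG]] := separating_functionals Glin Gcl Xsep.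
have [v [f vf]] := infinite_dim_biorthogonal Vinf.
have [M [M1 phiM]] := bounded_functional_bound phib.
have [|lam [lam0 Mlam _]] := fast_weights M1 (_ : 0 < 1 <= 1) ltr01.
  by rewrite ltr01 lexx.
have Mlam1 n : \sum_(j < n) M j * lam j <= 1.
  apply: le_trans (Mlam 1 _ n) => //; rewrite le_eqVlt; apply/orP/or_introl/eqP.
  by apply: eq_bigr => j _; rewrite powRr1// ltW.
have [T [Tconv Tle T0]] := series_operator vf (fun j => proj1 (phib j)) phiM lam0 Mlam1.
exists T, 1; split=> // x; split=> [/T0/phiG//|/phiG phi0].
apply: nrm_cvg_uniq (Tconv x) _; apply: (@nrm_cvg_eventually _ _ _ 0) => n _.
by rewrite big1// => j _; rewrite phi0 mulr0 scale0r.
Qed.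

(** Although y need not be in N, its image T y is a sum of images of vectors
    kappa_j y of N.  Here kappa_j y = phi_j(y) k_j with (k_j), (phi_j) biorthogonal,
    and T (kappa_j y) = lam_j phi_j(y) v_j is so small that the series converges even in the
    interpolation norms between N and V. *)
Lemma operator_injective_on (X : normedModType K) (V : completeNormedModType K)
    (N : set X) (eta tau0 : R) :
  (exists u, @dense_seq R s X u) -> linear_subspace N -> dimension [set: V] = None ->
  0 < eta <= 1 -> 0 < tau0 <= 1 ->
  exists (T : {linear X -> V}) (kappa : nat -> X -> X),
    [/\ forall x, nrm (T x) <= eta * nrm x,
        forall x, N x -> T x = 0 -> x = 0,
        forall j y, N (kappa j y),
        forall y, nrm_cvg (fun n => \sum_(j < n) T (kappa j y)) (T y)
      & forall tau, 0 < tau <= 1 -> exists C, [/\ 0 <= C, tau0 <= tau -> C <= eta &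
          forall n y, \sum_(j < n) nrm (kappa j y) `^ (1 - tau) * nrm (T (kappa j y)) `^ tau
            <= C * nrm y]].
Proof.
move=> Xsep Nlin Vinf eta01 /andP[tau00 tau01].
have zlin : linear_subspace [set 0 : X].
  by split=> // a _ _ -> ->; rewrite scaler0 addr0.
have zcl : closed [set 0 : X].
  exact: (@accessible_closed_set1 _ (hausdorff_accessible (@norm_hausdorff _ _))).
have [psi [psib psi0]] := separating_functionals zlin zcl Xsep.
have [phi [k [phib Nk phik phid phiN]]] := biorthogonalize Nlin psib.
have [v [f vf]] := infinite_dim_biorthogonal Vinf.
have [M [M1 phiM]] := bounded_functional_bound phib.
have [lam [lam0 Mlam Mlam']] := fast_weights M1 eta01 tau00.
have M0 j : 0 <= M j by rewrite (le_trans ler01).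
have Mlam1 n : \sum_(j < n) M j * lam j <= eta.
  apply: le_trans (Mlam 1 _ n) => //; rewrite le_eqVlt; apply/orP/or_introl/eqP.
  by apply: eq_bigr => j _; rewrite powRr1// ltW.
have [T [Tconv Tle T0]] := series_operator vf (fun j => proj1 (phib j)) phiM lam0 Mlam1.
have Tk j : T (k j) = (of_real s (lam j) * phi j (k j)) *: v j.
  apply: nrm_cvg_uniq (Tconv _) _; apply: (@nrm_cvg_eventually _ _ _ j.+1) => n ljn.
  rewrite (bigD1 (Ordinal ljn))//= big1 ?addr0// => i ij.
  by rewrite phik ?mulr0 ?scale0r.
have phiphi j y : phi j y * phi j (k j) = phi j y.
  by case: (phid j) => [->|[_ ->]]; rewrite ?mulr1 ?mul0r.
have Tkappa j y : T (phi j y *: k j) = (of_real s (lam j) * phi j y) *: v j.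
  by rewrite linearZ /= Tk scalerA mulrCA phiphi.
exists T, (fun j y => phi j y *: k j); split=> //.
- move=> x Nx Tx; apply/psi0; apply: phiN => //; exact: T0.
- by move=> j y; have [N0 /(_ (phi j y) (k j) 0 (proj1 (Nk j)) N0)] := Nlin; rewrite addr0.
- move=> y; rewrite [X in nrm_cvg X _](_ : _ = fun n =>
    \sum_(j < n) (of_real s (lam j) * phi j y) *: v j)//.
  by apply/funext => n; apply: eq_bigr => j _; exact: Tkappa.
move=> tau /andP[t0 t1].
have [C [Ceta MC]] : exists C, (tau0 <= tau -> C <= eta) /\
    forall n, \sum_(j < n) M j * lam j `^ tau <= C.
  have [tt|tt] := leP tau0 tau; first by exists eta; split=> // n; exact: Mlam.
  by have [C MC] := Mlam' tau t0; exists C; split=> //; rewrite leNgt tt.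
exists C; split=> // [|n y]; first by have := MC 0%N; rewrite big_ord0.
apply: (@le_trans _ _ (\sum_(j < n) M j * lam j `^ tau * nrm y)); last first.
  by rewrite -mulr_suml ler_wpM2r ?nrm_ge0.
apply: ler_sum => j _; rewrite Tkappa !nrmZ; have [-> _ _] := vf.
have [_ nk] := Nk j; rewrite mulr1 modulusM modulus_of_real gtr0_norm//.
set a := modulus (phi j y); have a0 : 0 <= a := modulus_ge0 _.
have l0 := ltW (lam0 j).
rewrite [lam j * a]mulrC [(a * lam j) `^ _]powRM// mulrA.
rewrite [M j * _ * _]mulrAC ler_wpM2r ?powR_ge0//.
apply: le_trans (phiM j y); rewrite -/a.
have ak : (a * nrm (k j)) `^ (1 - tau) <= a `^ (1 - tau).
  apply: ge0_ler_powR; rewrite ?nnegrE ?subr_ge0 ?mulr_ge0 ?nrm_ge0//.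
  by rewrite ler_piMr.
apply: le_trans (ler_wpM2r (powR_ge0 a tau) ak) _.
by rewrite -powRD subrK ?powRr1// oner_eq0.
Qed.

End series_operators.

(** * Couples and interpolation methods *)

Section l1_product.
Variable K : numFieldType.

(** A separate name, because the product type carries the maximum norm. *)
Definition l1prod (X V : normedModType K) : Type := (X * V)%type.

Section norm.
Variables X V : normedModType K.

HB.instance Definition _ := GRing.Lmodule.copy (l1prod X V) (X * V)%type.

Definition l1norm (p : l1prod X V) : K := `|p.1| + `|p.2|.

Lemma l1norm_triangle p q : l1norm (p + q) <= l1norm p + l1norm q.
Proof. by rewrite /l1norm addrACA lerD ?ler_normD. Qed.
Lemma l1normZ a p : l1norm (a *: p) = `|a| * l1norm p.
Proof. by rewrite /l1norm /= !normrZ mulrDr. Qed.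
Lemma l1norm_eq0 p : l1norm p = 0 -> p = 0.
Proof.
case: p => x v /eqP; rewrite paddr_eq0 ?normr_ge0//= => /andP[].
by rewrite !normr_eq0 => /eqP -> /eqP ->.
Qed.

HB.instance Definition _ :=
  Lmodule_isNormed.Build K (l1prod X V) l1norm_triangle l1normZ l1norm_eq0.

Lemma l1prod_normE (p : l1prod X V) : `|p| = `|p.1| + `|p.2|.
Proof. by []. Qed.

End norm.

Section complete.
Variables X V : completeNormedModType K.

Lemma l1prod_complete (F : set_system (l1prod X V)) : ProperFilter F -> cauchy F -> cvg F.
Proof.
move=> FF cF.
have cauchy_image (Y : completeNormedModType K) (g : l1prod X V -> Y) :
    (forall p q, `|g p - g q| <= `|p - q|) -> cvg (g @ F).
  move=> g1; apply: cauchy_cvg; apply: cauchy_exP => e e0.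
  have [p Fp] := proj1 (cauchyP F) cF e e0; exists (g p).
  rewrite /nbhs /=; apply: filterS Fp => q; rewrite -!ball_normE /=.
  exact: le_lt_trans.
have /cvg_ex[x Fx] : cvg ((fun p : l1prod X V => p.1) @ F).
  by apply: cauchy_image => p q; rewrite [leRHS]l1prod_normE lerDl.
have /cvg_ex[v Fv] : cvg ((fun p : l1prod X V => p.2) @ F).
  by apply: cauchy_image => p q; rewrite [leRHS]l1prod_normE lerDr.
apply/cvg_ex; exists ((x, v) : l1prod X V) => A /nbhs_ballP[e /= e0 eA].
have e20 : 0 < e / 2 by rewrite divr_gt0.
have Fx2 : F [set p | ball x (e / 2) p.1] := Fx _ (nbhsx_ballx x _ e20).
have Fv2 : F [set p | ball v (e / 2) p.2] := Fv _ (nbhsx_ballx v _ e20).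
apply: filterS (filterI Fx2 Fv2) => p []; rewrite -!ball_normE /= => px pv.
apply: eA; rewrite -ball_normE /= [ltLHS]l1prod_normE [e]splitr.
exact: ltrD.
Qed.

HB.instance Definition _ := Uniform_isComplete.Build (l1prod X V) l1prod_complete.
End complete.
End l1_product.

Section couples.
Variables (R : realType) (s : scalar_kind).
Local Notation K := (scalar_field R s).

Lemma nrm_l1prod (X V : normedModType K) (p : l1prod X V) :
  nrm (p : l1prod X V) = nrm p.1 + nrm p.2.
Proof. by rewrite /nrm [`|p|]l1prod_normE reD. Qed.

Lemma norm_in_emb (U : topologicalLmodType K) (A : embedded U) (a : carrier A) :
  norm_in A (emb A a) = nrm a.
Proof.
rewrite /norm_in; congr nrm; apply: (@emb_inj _ _ _ A).
exact: (xgetPex 0 (ex_intro _ a erefl : exists b, emb A b = emb A a)).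
Qed.

Section opnorm.
Variables (U V : Type) (D : set U) (p : U -> R) (q : V -> R) (f : U -> V).

Lemma opnorm_le C : (forall x, D x -> p x <= 1 -> q (f x) <= C) ->
  (opnorm D p q f <= C%:E)%E.
Proof.
by move=> fC; apply: ge_ereal_sup => _ [x [Dx px] <-]; rewrite lee_fin; exact: fC.
Qed.

Lemma opnorm_ge x : D x -> p x <= 1 -> ((q (f x))%:E <= opnorm D p q f)%E.
Proof. by move=> Dx px; apply: ereal_sup_ubound; exists x. Qed.

Lemma opnorm_ge0 x : D x -> p x <= 1 -> 0 <= q (f x) -> (0 <= opnorm D p q f)%E.
Proof. by move=> Dx px qx; apply: le_trans (opnorm_ge Dx px); rewrite lee_fin. Qed.
End opnorm.

Lemma opnorm_in_ge0 (U V : topologicalLmodType K) (A : embedded U)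
  (B : embedded V) (T : U -> V) : (0 <= opnorm_in A B T)%E.
Proof.
apply: (@opnorm_ge0 _ _ _ _ _ _ (emb A 0)); first by exists 0.
  by rewrite norm_in_emb nrm0 ler01.
exact: nrm_ge0.
Qed.

Lemma opnorm_in_le (U V : topologicalLmodType K) (A : embedded U)
    (B : embedded V) (T : U -> V) C :
  (forall a, nrm a <= 1 -> norm_in B (T (emb A a)) <= C) ->
  (opnorm_in A B T <= C%:E)%E.
Proof.
by move=> TC; apply: opnorm_le => _ [a _ <-]; rewrite norm_in_emb; exact: TC.
Qed.

Definition self_embedded (V : completeNormedModType K) : embedded V :=
  @Embedded R s V V idfun (fun x y => id) (fun x => @cvg_id _ _).

Definition constant_couple (V : completeNormedModType K) : couple R s :=
  @Couple R s V (@norm_hausdorff _ _) (self_embedded V) (self_embedded V).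

Lemma norm_in_self (V : completeNormedModType K) (v : V) :
  norm_in (self_embedded V) v = nrm v.
Proof. exact: (@norm_in_emb _ (self_embedded V) v). Qed.

Lemma emb_constant (V : completeNormedModType K) v :
  subspace_of (self_embedded V) v.
Proof. by exists v. Qed.

Variable I : interp_method R s.

Lemma exponential_bound_le (theta c C0 C1 : R) (A B : couple R s)
    (T : ambient A -> ambient B) :
  0 < theta < 1 -> 0 <= c -> exponential_bound I theta c ->
  linear_on (sum_space A) T ->
  T @` subspace_of (side0 A) `<=` subspace_of (side0 B) ->
  T @` subspace_of (side1 A) `<=` subspace_of (side1 B) ->
  (opnorm_in (side0 A) (side0 B) T <= C0%:E)%E ->
  (opnorm_in (side1 A) (side1 B) T <= C1%:E)%E ->
  forall x, subspace_of (I A) x -> norm_in (I A) x <= 1 ->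
    subspace_of (I B) (T x) /\ norm_in (I B) (T x) <= c * (C0 `^ (1 - theta) * C1 `^ theta).
Proof.
move=> /andP[t0 t1] c0 Iexp Tlin T0 T1 TC0 TC1 x Ix nx.
have TT : couple_map T.
  by split=> //; [apply: le_lt_trans TC0 _ | apply: le_lt_trans TC1 _]; rewrite ltry.
have [TI _] := interp_map I TT; split; first by apply: TI; exists x.
rewrite -lee_fin; apply: le_trans (opnorm_ge _ _ Ix nx) _; apply: le_trans (Iexp _ _ _ TT) _.
rewrite EFinM lee_wpmul2l ?lee_fin// EFinM -!poweR_EFin.
have mono C (r : R) z : (0 <= r) -> (0 <= z)%E -> (z <= C%:E)%E -> (poweR z r <= poweR C%:E r)%E.
  move=> r0 z0 zC; apply: gt0_ler_poweR => //; rewrite in_itv /= ?z0 ?leey//.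
  by rewrite (le_trans z0 zC) ?leey.
apply: lee_pmul; rewrite ?poweR_ge0//; apply: mono => //; rewrite ?opnorm_in_ge0//.
- by rewrite subr_ge0 ltW.
- exact: ltW.
Qed.

(** Apply the exponential inequality to the rank-one maps f(.)x out of (V, V), whose
    norms into the two sides are proportional to those of x. *)
Lemma interp_common_element (V : completeNormedModType K) (v : V)
    (theta c c1 : R) (A : couple R s) (a0 : carrier (side0 A)) (a1 : carrier (side1 A)) :
  v <> 0 -> 0 < theta < 1 -> 0 <= c -> exponential_bound I theta c ->
  0 < c1 -> norm_bounds I c1 -> emb (side0 A) a0 = emb (side1 A) a1 ->
  exists a : carrier (I A), emb (I A) a = emb (side0 A) a0 /\
    nrm a <= c * c1 * (nrm a0 `^ (1 - theta) * nrm a1 `^ theta).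
Proof.
move=> v0 t01 c0 Iexp c10 Ibd a01; set x := emb (side0 A) a0.
have [f [fl fM fv]] := norming v.
have nv : 0 < nrm v by exact: nrm_gt0.
have fv0 : f v != 0.
  by apply/eqP => fv0; move: nv; rewrite -fv fv0 modulus0 ltxx.
(* normalized so that w has interpolation norm at most 1 and g takes the value 1 at w *)
pose b := of_real s (c1 * nrm v).
have b0 : b != 0.
  by apply/eqP; rewrite -(of_real0 R s) => /of_real_inj/eqP; rewrite gt_eqF// mulr_gt0.
pose w := b^-1 *: v; pose g (y : V) := b / f v * f y.
have gl : functional g by move=> k y z; rewrite /g fl; ring.
have gw : g w = 1.
  by rewrite /g /w functionalZ// mulrACA mulfV// mulVf// mulr1.
have sb : modulus b = c1 * nrm v by rewrite modulus_of_real gtr0_norm// mulr_gt0.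
have sV (k : K) : k != 0 -> modulus k^-1 = (modulus k)^-1.
  move=> k0; have sk0 : modulus k != 0 by apply: contra k0 => /eqP/modulus_eq0/eqP.
  by apply: (mulfI sk0); rewrite -modulusM !mulfV// modulus1.
have gM y : modulus (g y) <= c1 * nrm y.
  rewrite /g !modulusM sb sV// fv mulfK ?gt_eqF// ler_wpM2l ?(ltW c10)//.
have nw : nrm w = c1^-1.
  by rewrite nrmZ sV// sb invfM mulfVK// gt_eqF.
pose T (y : V) : ambient A := g y *: x.
have TE (Ai : embedded (ambient A)) (a : carrier Ai) : emb Ai a = x ->
    forall y, T y = emb Ai (g y *: a) by move=> ax y; rewrite linearZ /= ax.
have Tle (Ai : embedded (ambient A)) (a : carrier Ai) : emb Ai a = x ->
    (opnorm_in (self_embedded V) Ai T <= (c1 * nrm a)%:E)%E.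
  move=> ax; apply: opnorm_in_le => y ny; rewrite (TE _ _ ax) norm_in_emb nrmZ.
  rewrite ler_wpM2r ?nrm_ge0// (le_trans (gM y))// -[leRHS]mulr1.
  by rewrite ler_wpM2l// ltW.
have Tsub (Ai : embedded (ambient A)) (a : carrier Ai) : emb Ai a = x ->
    T @` subspace_of (self_embedded V) `<=` subspace_of Ai.
  by move=> ax _ [y _ <-]; rewrite (TE _ _ ax); eexists.
have capw : cap_space (constant_couple V) w by split; exact: emb_constant.
have nIw : norm_in (I (constant_couple V)) w <= 1.
  have [_ /(_ w capw)] := Ibd (constant_couple V).
  by rewrite /cap_norm /= !norm_in_self maxxx nw mulfV// gt_eqF.
have [|[a _ aT] na] := @exponential_bound_le theta c (c1 * nrm a0) (c1 * nrm a1)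
    (constant_couple V) A T t01 c0 Iexp _ (Tsub _ _ erefl) (Tsub _ _ (esym a01))
    (Tle _ _ erefl) (Tle _ _ (esym a01)) w (interp_cap I capw) nIw.
  by move=> k y z _ _; rewrite /T gl scalerDl scalerA.
exists a; rewrite aT /T gw scale1r; split=> //.
move: na; rewrite -aT norm_in_emb => na; apply: le_trans na _.
rewrite !powRM ?nrm_ge0 ?(ltW c10)// [in leLHS]mulrACA -[leRHS]mulrA ler_wpM2l// -powRD; last first.
  by rewrite subrK oner_eq0.
by rewrite subrK powRr1// ltW.
Qed.

(** The exponential inequality bounds T on A_I by a product with a factor 0. *)
Lemma interp_vanishing (V : completeNormedModType K) (theta c C0 C1 : R) (A : couple R s)
    (T : ambient A -> V) :
  0 < theta < 1 -> 0 <= c -> exponential_bound I theta c ->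
  linear_on (sum_space A) T ->
  (forall a, nrm (T (emb (side0 A) a)) <= C0 * nrm a) ->
  (forall a, nrm (T (emb (side1 A) a)) <= C1 * nrm a) ->
  C0 = 0 \/ C1 = 0 -> forall x, subspace_of (I A) x -> T x = 0.
Proof.
move=> t01 c0 Iexp Tlin T0 T1 C01 x [a _ <-].
wlog [C0p C1p] : C0 C1 T0 T1 C01 / 0 <= C0 /\ 0 <= C1.
  move=> h; apply: (h `|C0| `|C1|) => //.
  - by move=> b; rewrite (le_trans (T0 b))// ler_wpM2r ?nrm_ge0 ?ler_norm.
  - by move=> b; rewrite (le_trans (T1 b))// ler_wpM2r ?nrm_ge0 ?ler_norm.
  - by case: C01 => ->; rewrite normr0; [left|right].
have Tle (Ai : embedded (ambient A)) C : 0 <= C ->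
    (forall b, nrm (T (emb Ai b)) <= C * nrm b) ->
    (opnorm_in Ai (self_embedded V) T <= C%:E)%E.
  move=> Cp TC; apply: opnorm_in_le => b nb; rewrite norm_in_self (le_trans (TC b))//.
  by rewrite -[leRHS]mulr1 ler_wpM2l.
have Tsub (Ai : embedded (ambient A)) :
    T @` subspace_of Ai `<=` subspace_of (self_embedded V).
  by move=> _ [b _ <-]; exact: emb_constant.
(* the operator norm only sees the unit ball, hence the scaling by k *)
pose k := of_real s (nrm a + 1)^-1.
have na1 : 0 < nrm a + 1 by rewrite ltr_wpDl ?nrm_ge0.
have nka : norm_in (I A) (emb (I A) (k *: a)) <= 1.
  rewrite norm_in_emb nrmZ modulus_of_real gtr0_norm ?invr_gt0// mulrC ler_pdivrMr// mul1r.
  by rewrite lerDl.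
have [[b _ bT] nb] := @exponential_bound_le theta c C0 C1 A (constant_couple V) T
    t01 c0 Iexp Tlin (Tsub _) (Tsub _) (Tle _ _ C0p T0) (Tle _ _ C1p T1)
    _ (imageT (emb (I A)) (k *: a)) nka.
move/andP: t01 => [t0 t1].
have b0 : b = 0.
  apply: nrm_le0; move: nb; rewrite -bT norm_in_emb => nb; apply: le_trans nb _.
  case: C01 => ->; rewrite powR0 ?mul0r ?mulr0//; last exact: lt0r_neq0.
  by rewrite subr_eq0 gt_eqF.
move: bT; rewrite b0 !linear0 linearZ /=.
have A0 : sum_space A 0 by exists 0, 0; split; [exists 0|exists 0|]; rewrite ?linear0 ?addr0.
have Aa : sum_space A (emb (I A) a) by apply: (interp_sum (i := I)); exists a.
have T00 : T 0 = 0 by apply: nrm_le0; rewrite -(linear0 (emb (side0 A))) (le_trans (T0 0))// nrm0 mulr0.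
rewrite -[k *: _]addr0 Tlin// T00 addr0 => /esym/eqP; rewrite scaler_eq0 => /orP[|/eqP//].
by rewrite -(of_real0 R s) (inj_eq (@of_real_inj R s)) invr_eq0 gt_eqF.
Qed.

(** Absolutely convergent series of common elements stay in A_I; their sum may
    be computed in the ambient space. *)
Lemma interp_series (V : completeNormedModType K) (v : V) (theta c c1 B : R) (A : couple R s)
    (a0 : nat -> carrier (side0 A)) (a1 : nat -> carrier (side1 A)) (x : ambient A) :
  v <> 0 -> 0 < theta < 1 -> 0 <= c -> exponential_bound I theta c ->
  0 < c1 -> norm_bounds I c1 -> (forall j, emb (side0 A) (a0 j) = emb (side1 A) (a1 j)) ->
  (forall n, \sum_(j < n) nrm (a0 j) `^ (1 - theta) * nrm (a1 j) `^ theta <= B) ->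
  (fun n => \sum_(j < n) emb (side0 A) (a0 j)) @ \oo --> x ->
  exists a : carrier (I A), emb (I A) a = x /\ nrm a <= c * c1 * B.
Proof.
move=> v0 t01 c0 Iexp c10 Ibd a01 aB ax.
have bEx j := interp_common_element v0 t01 c0 Iexp c10 Ibd (a01 j).
pose b j := projT1 (cid (bEx j)).
have bE j : emb (I A) (b j) = emb (side0 A) (a0 j) by rewrite /b; case: cid => ? [].
have bB j : nrm (b j) <= c * c1 * (nrm (a0 j) `^ (1 - theta) * nrm (a1 j) `^ theta).
  by rewrite /b; case: cid => ? [].
have [n|a [/nrm_cvg_cvg ba na]] := abs_series bB (C := c * c1 * B).
  by rewrite -mulr_sumr ler_wpM2l// mulr_ge0// ltW.
exists a; split=> //.
apply: (cvg_unique (@ambient_hausdorff _ _ A)) ax.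
have -> : (fun n => \sum_(j < n) emb (side0 A) (a0 j)) =
    (fun n => emb (I A) (\sum_(j < n) b j)).
  by apply/funext => n; rewrite linear_sum; apply: eq_bigr => j _.
exact: (cvg_comp _ _ ba (@emb_cont _ _ _ (I A) a)).
Qed.
End couples.

Section complementation.
Variables (R : realType) (s : scalar_kind).
Local Notation K := (scalar_field R s).
Variables (Z : completeNormedModType K) (U : topologicalLmodType K) (B : embedded U).
Variables (W : set U) (P : U -> Z) (E : {linear Z -> U}) (CE CP : R).
Hypotheses (BW : subspace_of B `<=` W) (PW : linear_on W P) (PE : forall z, P (E z) = z).
Hypotheses (EB : forall z, exists a : carrier B, emb B a = E z /\ nrm a <= CE * nrm z).
Hypothesis PB : forall a : carrier B, nrm (P (emb B a)) <= CP * nrm a.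
Hypotheses (CE0 : 0 <= CE) (CP0 : 0 <= CP).

Lemma opnorm_bounded (X Y : normedModType K) (D : set X) (f : X -> Y) C : 0 <= C ->
  (forall x, D x -> nrm (f x) <= C * nrm x) ->
  (opnorm D (@nrm R s X) (@nrm R s Y) f <= C%:E)%E.
Proof.
move=> C0 fC; apply: opnorm_le => x Dx x1; rewrite (le_trans (fC x Dx))//.
by rewrite -[leRHS]mulr1 ler_wpM2l.
Qed.

Lemma opnorm_subspace : (opnorm (subspace_of B) (norm_in B) (@nrm R s Z) P <= CP%:E)%E.
Proof.
apply: opnorm_le => _ [a _ <-]; rewrite norm_in_emb => a1.
by rewrite (le_trans (PB a))// -[leRHS]mulr1 ler_wpM2l.
Qed.

Lemma opnorm_section : (opnorm setT (@nrm R s Z) (norm_in B) E <= CE%:E)%E.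
Proof.
apply: opnorm_le => z _ z1; have [a [<- na]] := EB z; rewrite norm_in_emb.
by rewrite (le_trans na)// -[leRHS]mulr1 ler_wpM2l.
Qed.

Lemma range_section : range E `<=` subspace_of B.
Proof. by move=> _ [z _ <-]; have [a [<- _]] := EB z; exists a. Qed.

(** E, read in B, is an isomorphism onto its range, and E P is the projection. *)
Lemma complemented_copy : exists (S : set (carrier B)) (J : {linear Z -> carrier B})
    (G : carrier B -> Z) (p : {linear carrier B -> carrier B}),
  [/\ isomorphism_onto S J G, projection_onto S p,
      (opnorm setT (@nrm R s Z) (@nrm R s (carrier B)) J <= CE%:E)%E,
      (opnorm S (@nrm R s (carrier B)) (@nrm R s Z) G <= CP%:E)%E
    & (opnorm setT (@nrm R s (carrier B)) (@nrm R s (carrier B)) p <= (CE * CP)%:E)%E].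
Proof.
pose j z := projT1 (cid (EB z)).
have jE z : emb B (j z) = E z by rewrite /j; case: cid => ? [].
have jC z : nrm (j z) <= CE * nrm z by rewrite /j; case: cid => ? [].
have jlin : linear j.
  by move=> a x y; apply: (@emb_inj _ _ _ B); rewrite !linearP !jE linearP.
have [J JE] := linear_ex jlin.
have Wemb a : W (emb B a) by apply: BW; exists a.
have plin : linear (fun a => J (P (emb B a))).
  by move=> k x y; rewrite linearP PW// linearP.
have [p pE] := linear_ex plin.
have GJ z : P (emb B (J z)) = z by rewrite JE jE PE.
have JC : (opnorm setT (@nrm R s Z) (@nrm R s (carrier B)) J <= CE%:E)%E.
  by apply: opnorm_bounded => // z _; rewrite JE.
have GC : (opnorm (range J) (@nrm R s (carrier B)) (@nrm R s Z) (P \o emb B) <= CP%:E)%E.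
  by apply: opnorm_bounded => // a _; exact: PB.
exists (range J), J, (P \o emb B), p; split=> //.
- split=> //.
  + by move=> _ [z _ <-] /=; rewrite GJ.
  + by apply: le_lt_trans JC _; rewrite ltry.
  + by apply: le_lt_trans GC _; rewrite ltry.
- by split=> [x|_ [z _ <-]]; rewrite pE ?GJ//; eexists.
- apply: opnorm_bounded; first exact: mulr_ge0.
  move=> a _; rewrite pE JE (le_trans (jC _))// -mulrA ler_wpM2l//; exact: PB.
Qed.

Lemma complemented_copies : exists S : set (carrier B),
  isomorphic_onto Z S /\ complemented S.
Proof.
have [S [J [G [p [JG pS _ _ pC]]]]] := complemented_copy.
exists S; split; first by exists J, G.
by exists p; split=> //; apply: le_lt_trans pC _; rewrite ltry.
Qed.

Lemma complemented_copies_by lam : CE * CP <= lam -> exists S : set (carrier B),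
  isomorphic_onto_by Z S lam /\ complemented_by S lam.
Proof.
move=> lamC; have [S [J [G [p [JG pS JC GC pC]]]]] := complemented_copy.
have J0 : (0 <= opnorm setT (@nrm R s Z) (@nrm R s (carrier B)) J)%E.
  by apply: (@opnorm_ge0 _ _ _ _ _ _ _ 0) => //; rewrite ?nrm0 ?ler01 ?nrm_ge0.
have G0 : (0 <= opnorm S (@nrm R s (carrier B)) (@nrm R s Z) G)%E.
  apply: (@opnorm_ge0 _ _ _ _ _ _ _ 0); rewrite ?nrm0 ?ler01 ?nrm_ge0//.
  by case: JG => SJ _ _ _ _; rewrite -(linear0 J).
exists S; split.
  exists J, G; split=> //; apply: (@le_trans _ _ (CE * CP)%:E); last by rewrite lee_fin.
  by rewrite EFinM; exact: lee_pmul.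
by exists p; split=> //; rewrite (le_trans pC)// lee_fin.
Qed.
End complementation.

(** * The glued couple *)

Section construction.
Variables (R : realType) (s : scalar_kind).
Local Notation K := (scalar_field R s).
Variables X0 X1 V0 V1 : completeNormedModType K.
Variables (S : {linear (X0 * X1)%type -> V1}) (T1 : {linear X0 -> V1}) (T0 : {linear X1 -> V0}).

Local Notation A0 := (l1prod X0 V0).
Local Notation A1 := (l1prod X1 V1).
Local Notation U := (V1 * (V1 * V0))%type.

(** S glues X0 and X1; T1 and T0 record in V1 and V0 what S forgets of X0 and X1. *)
Definition emb0 (p : A0) : U := (S (p.1, 0), (T1 p.1, p.2)).
Definition emb1 (q : A1) : U := (S (0, q.1), (q.2, T0 q.1)).

Lemma emb0_linear : linear emb0.
Proof.
move=> a p q; rewrite /emb0 /= linearP.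
rewrite (_ : (a *: p.1 + q.1, 0) = a *: (p.1, 0) + (q.1, 0) :> X0 * X1); last first.
  by rewrite [RHS](_ : _ = (a *: p.1 + q.1, a *: 0 + 0))// scaler0 addr0.
by rewrite linearP.
Qed.
Lemma emb1_linear : linear emb1.
Proof.
move=> a p q; rewrite /emb1 /= [T0 _]linearP.
rewrite (_ : (0, a *: p.1 + q.1) = a *: (0, p.1) + (0, q.1) :> X0 * X1); last first.
  by rewrite [RHS](_ : _ = (a *: 0 + 0, a *: p.1 + q.1))// scaler0 addr0.
by rewrite linearP.
Qed.

HB.instance Definition _ := GRing.isLinear.Build K A0 U *:%R emb0 emb0_linear.
HB.instance Definition _ := GRing.isLinear.Build K A1 U *:%R emb1 emb1_linear.

Variable CS : R.
Hypotheses (CS0 : 0 <= CS) (S_le : forall p, nrm (S p) <= CS * nrm p).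
Hypotheses (T1_le : forall x, nrm (T1 x) <= nrm x) (T0_le : forall x, nrm (T0 x) <= nrm x).
Hypothesis S_T1 : forall x, S (x, 0) = 0 -> T1 x = 0 -> x = 0.
Hypothesis S_T0 : forall x, S (0, x) = 0 -> T0 x = 0 -> x = 0.

Lemma emb0_inj : injective emb0.
Proof.
move=> p q /eqP; rewrite -subr_eq0 -linearB => /eqP [Spq Tpq pq2].
apply/eqP; rewrite -subr_eq0; apply/eqP.
have pq1 : (p - q).1 = 0 by exact: S_T1.
have {}pq2 : (p - q).2 = 0 by exact: pq2.
by rewrite [LHS]surjective_pairing pq1 pq2.
Qed.
Lemma emb1_inj : injective emb1.
Proof.
move=> p q /eqP; rewrite -subr_eq0 -linearB => /eqP [Spq pq2 Tpq].
apply/eqP; rewrite -subr_eq0; apply/eqP.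
have pq1 : (p - q).1 = 0 by exact: S_T0.
have {}pq2 : (p - q).2 = 0 by exact: pq2.
by rewrite [LHS]surjective_pairing pq1 pq2.
Qed.

Lemma emb0_cont : continuous (emb0 : A0 -> U).
Proof.
apply: (@bounded_linear_cont _ _ _ _ _ (CS + 1)) => [x y|p]; first exact: linearB.
apply: le_trans (nrm_pair_le _ _) _; rewrite mulrDl mul1r nrm_l1prod lerD//.
  apply: le_trans (S_le _) _; rewrite nrm_pairl ler_wpM2l//.
  by rewrite lerDl nrm_ge0.
by apply: le_trans (nrm_pair_le _ _) _; rewrite lerD.
Qed.
Lemma emb1_cont : continuous (emb1 : A1 -> U).
Proof.
apply: (@bounded_linear_cont _ _ _ _ _ (CS + 1)) => [x y|p]; first exact: linearB.
apply: le_trans (nrm_pair_le _ _) _; rewrite mulrDl mul1r nrm_l1prod lerD//.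
  apply: le_trans (S_le _) _; rewrite nrm_pairr ler_wpM2l//.
  by rewrite lerDl nrm_ge0.
by apply: le_trans (nrm_pair_le _ _) _; rewrite addrC lerD.
Qed.

Definition glued_couple : couple R s :=
  @Couple R s U (@norm_hausdorff _ _)
    (@Embedded R s U A0 emb0 emb0_inj emb0_cont)
    (@Embedded R s U A1 emb1 emb1_inj emb1_cont).

Lemma l1prod_isometric (X V : completeNormedModType K) : isometric_to_sum (l1prod X V) X V.
Proof.
have idlin : linear (id : (X * V)%type -> l1prod X V) by [].
have [f fE] := linear_ex idlin; exists f; split; last by move=> p; rewrite fE nrm_l1prod.
by exists id => p /=; rewrite fE.
Qed.

Lemma S_sum (p : A0) (q : A1) : (emb0 p + emb1 q).1 = S (p.1, q.1).
Proof.
by rewrite /= -linearD; congr (S _); rewrite -[LHS]/(p.1 + 0, 0 + q.1) addr0 add0r.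
Qed.

(** Maps on X0 x X1 that vanish where S does induce maps on the ambient space. *)
Lemma induced_map (Y : lmodType K) (D : set (X0 * X1)) (h : X0 * X1 -> Y) :
  linear_subspace D -> linear_on D h -> (forall x, D x -> S x = 0 -> h x = 0) ->
  exists Phi : U -> Y,
    (forall (p : A0) (q : A1), D (p.1, q.1) -> Phi (emb0 p + emb1 q) = h (p.1, q.1)) /\
    let W := [set w : U | exists (p : A0) (q : A1), D (p.1, q.1) /\ w = emb0 p + emb1 q] in
    linear_subspace W /\ linear_on W Phi.
Proof.
move=> [D0 Dlin] hlin hS.
pose rel (w : U) := [set y | exists (p : A0) (q : A1),
  [/\ D (p.1, q.1), w = emb0 p + emb1 q & y = h (p.1, q.1)]].
pose Phi w := xget 0 (rel w).
have PhiE p q : D (p.1, q.1) -> Phi (emb0 p + emb1 q) = h (p.1, q.1).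
  move=> Dpq; have [p' [q' [Dpq' wE ->]]] : rel (emb0 p + emb1 q) (Phi (emb0 p + emb1 q)).
    by apply: (xgetPex 0); exists (h (p.1, q.1)), p, q.
  have Dd := Dlin (-1) _ _ Dpq Dpq'.
  have Sd : S ((-1) *: (p.1, q.1) + (p'.1, q'.1)) = 0.
    by rewrite linearP -!S_sum wE scaleN1r addNr.
  by have := hS _ Dd Sd; rewrite hlin// scaleN1r addrC => /subr0_eq.
have Wsum a p q p' q' : a *: (emb0 p + emb1 q) + (emb0 p' + emb1 q') =
    emb0 (a *: p + p') + emb1 (a *: q + q') by rewrite !linearP scalerDr addrACA.
exists Phi; split=> //; split; first split.
- by exists 0, 0; rewrite !linear0 addr0.
- move=> a _ _ [p [q [Dpq ->]]] [p' [q' [Dpq' ->]]].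
  exists (a *: p + p'), (a *: q + q'); split; first exact: (Dlin a _ _ Dpq Dpq').
  exact: Wsum.
- move=> a _ _ [p [q [Dpq ->]]] [p' [q' [Dpq' ->]]].
  rewrite Wsum !PhiE//; last exact: (Dlin a _ _ Dpq Dpq').
  exact: (hlin a _ _ Dpq Dpq').
Qed.

Lemma sum_space_glued : sum_space glued_couple =
  [set w | exists (p : A0) (q : A1), w = emb0 p + emb1 q].
Proof.
apply/seteqP; split=> [w [_ [_ [[p _ <-] [q _ <-] <-]]]|w [p [q ->]]]; first by exists p, q.
by exists (emb0 p), (emb1 q); split=> //; [exists p | exists q].
Qed.

Variables (Z : completeNormedModType K) (Y0 : set X0) (Y1 : set X1) (Q0 : X0 -> Z) (Q1 : X1 -> Z).
Hypotheses (Y0_lin : linear_subspace Y0) (Y1_lin : linear_subspace Y1).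
Hypotheses (Q0_lin : linear_on Y0 Q0) (Q1_lin : linear_on Y1 Q1).
Hypotheses (Q0_le : forall y, Y0 y -> nrm (Q0 y) <= nrm y).
Hypotheses (Q1_le : forall y, Y1 y -> nrm (Q1 y) <= nrm y).
Hypothesis Q0_lift : forall z e, 0 < e -> exists y, [/\ Y0 y, Q0 y = z & nrm y <= (1 + e) * nrm z].
Hypothesis Q1_lift : forall z e, 0 < e -> exists y, [/\ Y1 y, Q1 y = z & nrm y <= (1 + e) * nrm z].
Hypothesis S_ker : forall x x', S (x, x') = 0 <-> [/\ Y0 x, Y1 x' & Q0 x + Q1 x' = 0].

Definition liftable : set U := [set w | exists (p : A0) (q : A1),
  (Y0 p.1 /\ Y1 q.1) /\ w = emb0 p + emb1 q].

Lemma Q0_0 : Q0 0 = 0.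
Proof.
case: Y0_lin => Y00 _; have := Q0_lin (-1) Y00 Y00.
by rewrite scaler0 addr0 scaleN1r addNr.
Qed.
Lemma Q1_0 : Q1 0 = 0.
Proof.
case: Y1_lin => Y10 _; have := Q1_lin (-1) Y10 Y10.
by rewrite scaler0 addr0 scaleN1r addNr.
Qed.

Lemma glued_projection : exists P : U -> Z,
  [/\ linear_subspace liftable, linear_on liftable P &
    forall (p : A0) (q : A1), Y0 p.1 -> Y1 q.1 -> P (emb0 p + emb1 q) = Q0 p.1 + Q1 q.1].
Proof.
have [|||P [PE [Wlin Plin]]] := @induced_map Z
    [set x | Y0 x.1 /\ Y1 x.2] (fun x => Q0 x.1 + Q1 x.2).
- split; first by case: Y0_lin; case: Y1_lin.
  by move=> a [x x'] [y y'] /= [? ?] [? ?]; split; [case: Y0_lin|case: Y1_lin] => _; exact.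
- move=> a [x x'] [y y'] /= [? ?] [? ?].
  by rewrite Q0_lin// Q1_lin// scalerDr addrACA.
- by move=> [x x'] _ /S_ker[].
- by exists P; split=> // p q ? ?; exact: PE.
Qed.

Lemma glued_section : exists E : {linear Z -> U},
  forall z y, Y0 y -> Q0 y = z -> E z = (S (y, 0), (0, 0)).
Proof.
have lift z : exists y, Y0 y /\ Q0 y = z.
  by have [y [? ? _]] := Q0_lift z ltr01; exists y.
have S_congr y y' : Y0 y -> Y0 y' -> Q0 y = Q0 y' -> S (y, 0) = S (y', 0).
  move=> Yy Yy' yy'; apply/eqP; rewrite -subr_eq0 -linearB; apply/eqP.
  rewrite -[(y, 0) - _]/(y - y', 0 - 0) subr0; apply/S_ker; rewrite Q1_0 addr0.
  have -> : y - y' = (-1) *: y' + y by rewrite scaleN1r addrC.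
  split; [by case: Y0_lin => _; exact | by case: Y1_lin |].
  by rewrite Q0_lin// yy' scaleN1r addNr.
pose y z := projT1 (cid (lift z)).
have Yy z : Y0 (y z) by rewrite /y; case: cid => ? [].
have Qy z : Q0 (y z) = z by rewrite /y; case: cid => ? [].
have Elin : linear (fun z => (S (y z, 0), (0, 0)) : U).
  move=> a z z'; rewrite -[RHS]/(a *: S (y z, 0) + S (y z', 0), (a *: 0 + 0, a *: 0 + 0)).
  rewrite !scaler0 !addr0 -linearP; congr (_, _).
  rewrite (_ : a *: (y z, 0) + (y z', 0) = (a *: y z + y z', 0) :> X0 * X1); last first.
    by rewrite [LHS](_ : _ = (a *: y z + y z', a *: 0 + 0))// scaler0 addr0.
  apply: S_congr => //; first by case: Y0_lin => _; exact.
  by rewrite Q0_lin// !Qy.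
have [E EE] := linear_ex Elin; exists E => z x Yx Qx.
by rewrite EE (S_congr _ x)// Qy.
Qed.

Lemma section_decomposition y : (S (y, 0), (0, 0)) = emb0 (y, 0) + emb1 (0, - T1 y) :> U.
Proof.
rewrite -[RHS]/(S (y, 0) + S (0, 0), (T1 y - T1 y, 0 + T0 0)).
by rewrite (linear0 S : S (0, 0) = 0) linear0 !addr0 subrr.
Qed.

Variables (R0 : {linear X0 -> V0}) (R1 : {linear X1 -> V1}) (C0 C1 : R).
Hypotheses (R0_le : forall x, nrm (R0 x) <= C0 * nrm x) (R0_ker : forall x, R0 x = 0 <-> Y0 x).
Hypotheses (R1_le : forall x, nrm (R1 x) <= C1 * nrm x) (R1_ker : forall x, R1 x = 0 <-> Y1 x).
Variable I : interp_method R s.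
Variables (theta c c1 : R).
Hypotheses (theta01 : 0 < theta < 1) (c0 : 0 <= c) (c10 : 0 < c1).
Hypotheses (Iexp : exponential_bound I theta c) (Ibd : norm_bounds I c1).

Lemma le_l1 (X V Y : normedModType K) (p : l1prod X V) C (x : Y) : nrm x <= C * nrm p.1 ->
  nrm x <= `|C| * nrm (p : l1prod X V).
Proof.
move=> xp; apply: le_trans xp _; rewrite nrm_l1prod.
apply: le_trans (ler_wpM2r (nrm_ge0 _) (ler_norm C)) _.
by rewrite ler_wpM2l// lerDl nrm_ge0.
Qed.

(** The maps that x in X0 and x' in X1 induce modulo Y0 and Y1 vanish on one side
    of the couple, hence on A_I. *)
Lemma interp_decomposition (p : A0) (q : A1) :
  subspace_of (I glued_couple) (emb0 p + emb1 q) -> Y0 p.1 /\ Y1 q.1.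
Proof.
move=> Iw; split.
- have [|||T [TE [_ Tlin]]] := @induced_map V0 setT (fun x => R0 x.1).
  + by split.
  + by move=> a x y _ _; rewrite /= linearP.
  + by move=> [x x'] _ /S_ker[/R0_ker].
  apply/R0_ker; rewrite -(TE p q)//.
  apply: (@interp_vanishing _ _ I V0 theta c `|C0| 0 glued_couple T) => //; last by right.
  + move=> a x y; rewrite sum_space_glued => -[p1 [q1 ->]] [p2 [q2 ->]].
    by apply: Tlin; [exists p1, q1 | exists p2, q2].
  + move=> a /=; rewrite -[emb0 a]addr0 -(linear0 emb1) TE//=; exact: le_l1.
  + by move=> a /=; rewrite -[emb1 a]add0r -(linear0 emb0) TE//= linear0 nrm0 mul0r.
- have [|||T [TE [_ Tlin]]] := @induced_map V1 setT (fun x => R1 x.2).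
  + by split.
  + by move=> a x y _ _; rewrite /= linearP.
  + by move=> [x x'] _ /S_ker[_ /R1_ker].
  apply/R1_ker; rewrite -(TE p q)//.
  apply: (@interp_vanishing _ _ I V1 theta c 0 `|C1| glued_couple T) => //; last by left.
  + move=> a x y; rewrite sum_space_glued => -[p1 [q1 ->]] [p2 [q2 ->]].
    by apply: Tlin; [exists p1, q1 | exists p2, q2].
  + by move=> a /=; rewrite -[emb0 a]addr0 -(linear0 emb1) TE//= linear0 nrm0 mul0r.
  + move=> a /=; rewrite -[emb1 a]add0r -(linear0 emb0) TE//=; exact: le_l1.
Qed.

Lemma interp_liftable : subspace_of (I glued_couple) `<=` liftable.
Proof.
move=> w Iw; have := interp_sum Iw; rewrite sum_space_glued => -[p [q wE]].
by exists p, q; split=> //; apply: interp_decomposition; rewrite -wE.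
Qed.

(** By interp_decomposition the bound |Q0 x + Q1 x'| <= |x| + |x'| applies to every
    decomposition, and passes to the infimum, the norm of A_0 + A_1. *)
Lemma projection_le (P : U -> Z) (a : carrier (I glued_couple)) :
  (forall (p : A0) (q : A1), Y0 p.1 -> Y1 q.1 -> P (emb0 p + emb1 q) = Q0 p.1 + Q1 q.1) ->
  nrm (P (emb (I glued_couple) a)) <= c1 * nrm a.
Proof.
move=> PE; set w := emb _ a; have Iw : subspace_of (I glued_couple) w by exists a.
have [+ _] := Ibd glued_couple => /(_ w Iw); rewrite norm_in_emb ler_pdivrMl//.
apply: le_trans; apply: lb_le_inf.
  have [x0 [x1 [? ? ?]]] := interp_sum Iw.
  by exists (norm_in (side0 glued_couple) x0 + norm_in (side1 glued_couple) x1), x0, x1.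
move=> _ [_ [_ [[p _ <-] [q _ <-] wE ->]]]; rewrite !norm_in_emb -wE.
have [Yp Yq] : Y0 p.1 /\ Y1 q.1 by apply: interp_decomposition; rewrite wE.
rewrite PE// (le_trans (nrmD _ _))// !nrm_l1prod.
by rewrite lerD//; [apply: le_trans (Q0_le Yp) _|apply: le_trans (Q1_le Yq) _];
  rewrite lerDl nrm_ge0.
Qed.

Variables (v : V0) (v_neq0 : v <> 0) (eta B0 B1 : R).
Variables (kappa1 : nat -> X0 -> X0) (kappa0 : nat -> X1 -> X1).
Hypotheses (T1_eta : forall x, nrm (T1 x) <= eta * nrm x) (T0_eta : forall x, nrm (T0 x) <= eta * nrm x).
Hypotheses (eta0 : 0 < eta) (B00 : 0 <= B0) (B10 : 0 <= B1).
Hypothesis kappa1_ker : forall j y, quotient_kernel Y0 Q0 (kappa1 j y).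
Hypothesis kappa0_ker : forall j y, quotient_kernel Y1 Q1 (kappa0 j y).
Hypothesis kappa1_sum : forall y, nrm_cvg (fun n => \sum_(j < n) T1 (kappa1 j y)) (T1 y).
Hypothesis kappa0_sum : forall y, nrm_cvg (fun n => \sum_(j < n) T0 (kappa0 j y)) (T0 y).
Hypothesis kappa1_le : forall n y, \sum_(j < n)
  nrm (kappa1 j y) `^ (1 - theta) * nrm (T1 (kappa1 j y)) `^ theta <= B1 * nrm y.
Hypothesis kappa0_le : forall n y, \sum_(j < n)
  nrm (kappa0 j y) `^ theta * nrm (T0 (kappa0 j y)) `^ (1 - theta) <= B0 * nrm y.

Let nrm_l1l (X V : normedModType K) (x : X) : nrm ((x, 0) : l1prod X V) = nrm x.
Proof. by rewrite nrm_l1prod /= nrm0 addr0. Qed.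
Let nrm_l1r (X V : normedModType K) (x : V) : nrm ((0, x) : l1prod X V) = nrm x.
Proof. by rewrite nrm_l1prod /= nrm0 add0r. Qed.

(** Lift z to y in Y0 and y' in Y1.  The common element (y, T0 y') = (y', T1 y)
    has norms close to |z| on both sides, and differs from E z by T1 y and T0 y',
    which are sums of elements small in one of the two spaces. *)
Lemma section_le (E : {linear Z -> U}) (z : Z) :
  (forall z y, Y0 y -> Q0 y = z -> E z = (S (y, 0), (0, 0))) ->
  exists a : carrier (I glued_couple), emb (I glued_couple) a = E z /\
    nrm a <= c * c1 * ((1 + eta + B1 + B0) * (1 + eta)) * nrm z.
Proof.
move=> EE.
have [y [Yy Qy yz]] := Q0_lift z eta0; have [y' [Yy' Qy' yz']] := Q1_lift z eta0.
set M := (1 + eta) * nrm z in yz yz'.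
have subV1 (x x' : V1) : (0, (x, 0)) - (0, (x', 0)) = (0, (x - x', 0)) :> U.
  by rewrite -[LHS]/(0 - 0, (x - x', 0 - 0)) !subr0.
have subV0 (x x' : V0) : (0, (0, x)) - (0, (0, x')) = (0, (0, x - x')) :> U.
  by rewrite -[LHS]/(0 - 0, (0 - 0, x - x')) !subr0.
have S00 : S (0, 0) = 0 := linear0 S.
have [t0 t1] := andP theta01.
have cc1 : 0 <= c * c1 by rewrite mulr_ge0// ltW.
have M0 : 0 <= M by rewrite (le_trans (nrm_ge0 y)).
have T1k j x : emb0 (kappa1 j x, 0) = emb1 (0, T1 (kappa1 j x)).
  have [Yk Qk] := kappa1_ker j x; rewrite /emb0 /emb1 /= S00 linear0; congr (_, _).
  by apply/S_ker; rewrite Qk Q1_0 addr0; split=> //; case: Y1_lin.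
have T0k j x : emb0 (0, T0 (kappa0 j x)) = emb1 (kappa0 j x, 0).
  have [Yk Qk] := kappa0_ker j x; rewrite /emb0 /emb1 /= S00 linear0; congr (_, _).
  by apply/esym/S_ker; rewrite Qk Q0_0 addr0; split=> //; case: Y0_lin.
have uE : emb0 (y, T0 y') = emb1 (y', T1 y).
  rewrite /emb0 /emb1 /=; congr (_, _); apply/eqP; rewrite -subr_eq0 -linearB.
  rewrite -[(y, 0) - _]/(y - 0, 0 - y') subr0 sub0r; apply/eqP/S_ker.
  have -> : - y' = (-1) *: y' + 0 by rewrite scaleN1r addr0.
  have Y10 : Y1 0 by case: Y1_lin.
  split=> //; first by case: Y1_lin => _; exact.
  by rewrite Q1_lin// Q1_0 addr0 scaleN1r Qy Qy' subrr.
have [a [aE na]] := interp_common_element (A := glued_couple) v_neq0 theta01 c0 Iexp c10 Ibd uE.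
have [||b [bE nb]] := interp_series (A := glued_couple) (B := B1 * M)
    (x := (0, (T1 y, 0)) : U) v_neq0 theta01 c0 Iexp c10 Ibd (T1k^~ y).
- move=> n; under eq_bigr do rewrite nrm_l1l nrm_l1r.
  by rewrite (le_trans (kappa1_le n y))// ler_wpM2l.
- apply: nrm_cvg_cvg => e e0; have [N yN] := kappa1_sum y e0; exists N => n /yN.
  rewrite (_ : \sum_(j < n) _ = (0, (\sum_(j < n) T1 (kappa1 j y), 0)) :> U).
    by rewrite subV1 nrm_pairr nrm_pairl.
  elim: n => [|n IH]; first by rewrite !big_ord0.
  rewrite !big_ord_recr IH /= T1k /emb1 /= S00 linear0.
  by rewrite -[LHS]/(0 + 0, (_ + T1 (kappa1 n y), 0 + 0)) !addr0.
have [||d [dE nd]] := interp_series (A := glued_couple) (B := B0 * M)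
    (x := (0, (0, T0 y')) : U) v_neq0 theta01 c0 Iexp c10 Ibd (T0k^~ y').
- move=> n; under eq_bigr do rewrite nrm_l1l nrm_l1r mulrC.
  by rewrite (le_trans (kappa0_le n y'))// ler_wpM2l.
- apply: nrm_cvg_cvg => e e0; have [N yN] := kappa0_sum y' e0; exists N => n /yN.
  rewrite (_ : \sum_(j < n) _ = (0, (0, \sum_(j < n) T0 (kappa0 j y'))) :> U).
    by rewrite subV0 !nrm_pairr.
  elim: n => [|n IH]; first by rewrite !big_ord0.
  rewrite !big_ord_recr IH /= /emb0 /= S00 linear0.
  by rewrite -[LHS]/(0 + 0, (0 + 0, _ + T0 (kappa0 n y'))) !addr0.
exists (a - b - d); split.
  rewrite !linearB /= aE bE dE (EE z y)// /emb0 /=.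
  rewrite -[LHS]/(S (y, 0) - 0 - 0, (T1 y - T1 y - 0, T0 y' - 0 - T0 y')).
  by rewrite !subr0 !subrr.
have nM : nrm a <= c * c1 * ((1 + eta) * M).
  apply: le_trans na _; rewrite ler_wpM2l// !nrm_l1prod /=.
  set L := (1 + eta) * M; have L0 : 0 <= L by rewrite mulr_ge0// addr_ge0// ltW.
  have <- : L `^ (1 - theta) * L `^ theta = L.
    by rewrite -powRD subrK ?powRr1// oner_eq0.
  have LM : L = M + eta * M by rewrite /L mulrDl mul1r.
  apply: ler_pM; rewrite ?powR_ge0//; apply: ge0_ler_powR;
    rewrite ?subr_ge0 ?(ltW t0) ?(ltW t1) ?nnegrE ?addr_ge0 ?nrm_ge0//.
  - by rewrite LM lerD// (le_trans (T0_eta y'))// ler_wpM2l// ltW.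
  - by rewrite LM lerD// (le_trans (T1_eta y))// ler_wpM2l// ltW.
have := nrmB (a - b) d; have := nrmB a b.
have -> : c * c1 * ((1 + eta + B1 + B0) * (1 + eta)) * nrm z =
    c * c1 * ((1 + eta) * M) + c * c1 * (B1 * M) + c * c1 * (B0 * M) by rewrite /M; ring.
by lra.
Qed.

End construction.

(** * The theorem *)

Section quotient_maps.
Variables (R : realType) (s : scalar_kind).
Local Notation K := (scalar_field R s).
Variables (X Z : completeNormedModType K) (Y : set X) (Q : X -> Z).
Hypotheses (Y_sub : linear_subspace Y) (Q_quot : quotient_mapping Y Q).

Let inf_bound z : has_lbound [set nrm y | y in [set y | Y y /\ Q y = z]].
Proof. by exists 0 => _ [y _ <-]; exact: nrm_ge0. Qed.

Lemma quotient_0 : Q 0 = 0.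
Proof.
case: Q_quot => Qlin _ _ _; case: Y_sub => Y00 _; have := Qlin (-1) _ _ Y00 Y00.
by rewrite scaler0 addr0 scaleN1r addNr.
Qed.

Lemma quotient_le y : Y y -> nrm (Q y) <= nrm y.
Proof.
by move=> Yy; case: Q_quot => _ _ _ ->; apply: (ge_inf (inf_bound (Q y))); exists y.
Qed.

Lemma quotient_lift z e : 0 < e -> exists y, [/\ Y y, Q y = z & nrm y <= (1 + e) * nrm z].
Proof.
move=> e0; have [->|/eqP z0] := eqVneq z 0.
  by exists 0; rewrite !nrm0 mulr0 quotient_0; split=> //; case: Y_sub.
case: Q_quot => _ _ Qsurj Qnrm.
have hz : has_inf [set nrm y | y in [set y | Y y /\ Q y = z]].
  split; last exact: inf_bound.
  have [y Yy Qy] : (Q @` Y) z by rewrite Qsurj.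
  by exists (nrm y); exists y.
have [_ [y [Yy Qy] <-]] := inf_adherent (mulr_gt0 e0 (nrm_gt0 z0)) hz.
by rewrite -Qnrm => /ltW yz; exists y; split=> //; rewrite mulrDl mul1r.
Qed.

Lemma quotient_kernel_sub : linear_subspace (quotient_kernel Y Q).
Proof.
case: (Q_quot) => Qlin _ _ _; case: (Y_sub) => Y00 Ylin.
split; first by split=> //; exact: quotient_0.
move=> a x y [Yx Qx] [Yy Qy]; split; first exact: Ylin.
by rewrite Qlin// Qx Qy scaler0 addr0.
Qed.
End quotient_maps.

Section kernel_pairs.
Variables (R : realType) (s : scalar_kind).
Local Notation K := (scalar_field R s).
Variables (Z X0 X1 : completeNormedModType K).
Variables (Y0 : set X0) (Y1 : set X1) (Q0 : X0 -> Z) (Q1 : X1 -> Z).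
Hypotheses (Y0_sub : linear_subspace Y0) (Y1_sub : linear_subspace Y1).
Hypotheses (Y0_closed : closed Y0) (Y1_closed : closed Y1).
Hypotheses (Q0_quot : quotient_mapping Y0 Q0) (Q1_quot : quotient_mapping Y1 Q1).

(** Dividing X0 x X1 by these pairs glues Y0 and Y1 along Z, up to a sign. *)
Definition kernel_pairs : set (X0 * X1) :=
  [set x | [/\ Y0 x.1, Y1 x.2 & Q0 x.1 + Q1 x.2 = 0]].

Lemma kernel_pairs_sub : linear_subspace kernel_pairs.
Proof.
case: (Q0_quot) => Q0lin _ _ _; case: (Q1_quot) => Q1lin _ _ _.
case: (Y0_sub) => Y00 Y0lin; case: (Y1_sub) => Y10 Y1lin.
split; first by split=> //=; rewrite (quotient_0 Y0_sub)// (quotient_0 Y1_sub)// addr0.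
move=> a [x x'] [y y'] [/= Yx Yx' xx'] [/= Yy Yy' yy']; split => /=.
- exact: Y0lin.
- exact: Y1lin.
- by rewrite Q0lin// Q1lin// addrACA -scalerDr xx' yy' scaler0 addr0.
Qed.

Lemma kernel_pairs_closed : closed kernel_pairs.
Proof.
apply: (@nrm_closed R s) => -[x x'] near_x.
have split_pair y y' : nrm ((x, x') - (y, y') : X0 * X1) = nrm ((x - y, x' - y') : X0 * X1) by [].
have Yx : Y0 x.
  apply: (closed_nrm Y0_closed) => e /near_x[[y y'] [/= Yy _ _]].
  rewrite split_pair => h; exists y => //; apply: le_lt_trans h.
  by have [] := nrm_pair_ge (x - y) (x' - y').
have Yx' : Y1 x'.
  apply: (closed_nrm Y1_closed) => e /near_x[[y y'] [/= _ Yy' _]].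
  rewrite split_pair => h; exists y' => //; apply: le_lt_trans h.
  by have [] := nrm_pair_ge (x - y) (x' - y').
split=> //=; apply: nrm_le0; apply/ler_addgt0Pr => e e0; rewrite add0r.
have [[y y'] [/= Yy Yy' yy']] := near_x (e / 2) (divr_gt0 e0 (ltr0Sn _ _)).
rewrite split_pair; have [h h'] := nrm_pair_ge (x - y) (x' - y').
have sub (X : completeNormedModType K) (Y : set X) (Q : X -> Z) a b : linear_subspace Y ->
    quotient_mapping Y Q -> Y a -> Y b -> Y (a - b) /\ Q a - Q b = Q (a - b).
  move=> [_ Ylin] [Qlin _ _ _] Ya Yb.
  have -> : a - b = (-1) *: b + a by rewrite scaleN1r addrC.
  by split; [exact: Ylin | rewrite Qlin// scaleN1r addrC].
have [Y0d Q0d] := sub _ _ _ _ _ Y0_sub Q0_quot Yx Yy.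
have [Y1d Q1d] := sub _ _ _ _ _ Y1_sub Q1_quot Yx' Yy'.
have -> : Q0 x + Q1 x' = Q0 (x - y) + Q1 (x' - y').
  by rewrite -Q0d -Q1d addrACA -opprD yy' subr0.
have := nrmD (Q0 (x - y)) (Q1 (x' - y')).
by have := quotient_le Q0_quot Y0d; have := quotient_le Q1_quot Y1d; lra.
Qed.
End kernel_pairs.

Theorem theorem1 (R : realType) (s : scalar_kind)
  (Z X0 X1 V0 V1 : completeNormedModType (scalar_field R s))
  (Y0 : set X0) (Y1 : set X1) (Q0 : X0 -> Z) (Q1 : X1 -> Z)
  (eps theta0 theta1 : R)
  (X0_sep : separable_space X0) (X1_sep : separable_space X1)
  (Y0_sub : linear_subspace Y0) (Y1_sub : linear_subspace Y1)
  (Y0_closed : closed Y0) (Y1_closed : closed Y1)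
  (Q0_quot : quotient_mapping Y0 Q0) (Q1_quot : quotient_mapping Y1 Q1)
  (dim_Y : dimension Y0 = dimension Y1)
  (codim_Y : codimension Y0 = codimension Y1)
  (dim_ker : dimension (quotient_kernel Y0 Q0) = dimension (quotient_kernel Y1 Q1))
  (eps_bounds : 0 < eps < 1)
  (theta0_gt0 : 0 < theta0) (theta01 : theta0 <= theta1)
  (theta1_lt1 : theta1 < 1)
  (V0_inf : dimension [set: V0] = None) (V1_inf : dimension [set: V1] = None)
  (V0_sep : separable_space V0) (V1_sep : separable_space V1) :
  exists (A : couple R s) (W : set (ambient A))
         (P : ambient A -> Z) (E : {linear Z -> ambient A}),
    [/\ [/\ linear_subspace W, W `<=` sum_space A, linear_on W P
          & forall z, W (E z)],
        isometric_to_sum (carrier (side0 A)) X0 V0,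
        isometric_to_sum (carrier (side1 A)) X1 V1,
        (forall z, P (E z) = z)
      & forall (I : interp_method R s) (theta : R), exponential I theta ->
        [/\ [/\ subspace_of (I A) `<=` W,
                (opnorm (subspace_of (I A)) (norm_in (I A)) (@nrm R s Z) P < +oo)%E
              & exact_exponential I theta -> theta0 <= theta <= theta1 ->
                (opnorm (subspace_of (I A)) (norm_in (I A)) (@nrm R s Z) P
                   < (1 + eps / 3)%:E)%E],
            [/\ range E `<=` subspace_of (I A),
                (opnorm setT (@nrm R s Z) (norm_in (I A)) E < +oo)%E
              & exact_exponential I theta -> theta0 <= theta <= theta1 ->
                (opnorm setT (@nrm R s Z) (norm_in (I A)) E
                   < (1 + eps / 3)%:E)%E],
            (exists S : set (carrier (I A)),
               isomorphic_onto Z S /\ complemented S)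
          & exact_exponential I theta -> theta0 <= theta <= theta1 ->
            exists S : set (carrier (I A)),
              isomorphic_onto_by Z S (1 + eps) /\ complemented_by S (1 + eps)]].
Proof.
have /andP[eps0 eps1] := eps_bounds.
(* The estimates for E give (1 + 3 eta)(1 + eta) <= 1 + 7 eta, and
   7 / 30 < 1 / 3; T1 sees theta and T0 sees 1 - theta, whence tau0. *)
pose eta := eps / 30; pose tau0 := Num.min theta0 (1 - theta1).
have eta0 : 0 < eta by rewrite divr_gt0.
have eta1 : eta <= 1 by rewrite /eta; lra.
have tau01 : 0 < tau0 <= 1.
  by rewrite lt_min theta0_gt0 subr_gt0 theta1_lt1 ge_min; apply/orP; left; lra.
have eta01 : 0 < eta <= 1 by rewrite eta0.
have X0d := separable_dense_seq X0_sep; have X1d := separable_dense_seq X1_sep.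
have [T1 [kappa1 [T1_eta T1_inj kappa1_ker kappa1_sum kappa1_le]]] :=
  operator_injective_on X0d (quotient_kernel_sub Y0_sub Q0_quot) V1_inf eta01 tau01.
have [T0 [kappa0 [T0_eta T0_inj kappa0_ker kappa0_sum kappa0_le]]] :=
  operator_injective_on X1d (quotient_kernel_sub Y1_sub Q1_quot) V0_inf eta01 tau01.
have [S [CS [S_le0 S_ker0]]] := operator_with_kernel (dense_seq_pair X0d X1d)
  (kernel_pairs_sub Y0_sub Y1_sub Q0_quot Q1_quot)
  (kernel_pairs_closed Y0_sub Y1_sub Y0_closed Y1_closed Q0_quot Q1_quot) V1_inf.
have [R0 [C0 [R0_le R0_ker]]] := operator_with_kernel X0d Y0_sub Y0_closed V0_inf.
have [R1 [C1 [R1_le R1_ker]]] := operator_with_kernel X1d Y1_sub Y1_closed V1_inf.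
have S_le x : nrm (S x) <= `|CS| * nrm x.
  by rewrite (le_trans (S_le0 x))// ler_wpM2r ?nrm_ge0 ?ler_norm.
have S_ker x x' : S (x, x') = 0 <-> [/\ Y0 x, Y1 x' & Q0 x + Q1 x' = 0] := S_ker0 (x, x').
have le1 (X : completeNormedModType (scalar_field R s)) (x : X) : eta * nrm x <= nrm x.
  by rewrite ler_piMl ?nrm_ge0.
have T1_le x : nrm (T1 x) <= nrm x by apply: le_trans (T1_eta x) (le1 _ x).
have T0_le x : nrm (T0 x) <= nrm x by apply: le_trans (T0_eta x) (le1 _ x).
have Q00 := quotient_0 Y0_sub Q0_quot; have Q10 := quotient_0 Y1_sub Q1_quot.
have S_T1 x : S (x, 0) = 0 -> T1 x = 0 -> x = 0.
  by move=> /S_ker[Yx _]; rewrite Q10 addr0 => Qx; exact: T1_inj.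
have S_T0 x : S (0, x) = 0 -> T0 x = 0 -> x = 0.
  by move=> /S_ker[_ Yx]; rewrite Q00 add0r => Qx; exact: T0_inj.
have Q0_lin : linear_on Y0 Q0 by case: Q0_quot.
have Q1_lin : linear_on Y1 Q1 by case: Q1_quot.
have Q0_le := @quotient_le _ _ _ _ _ _ Q0_quot; have Q1_le := @quotient_le _ _ _ _ _ _ Q1_quot.
have Q0_lift := quotient_lift Y0_sub Q0_quot; have Q1_lift := quotient_lift Y1_sub Q1_quot.
pose A := glued_couple (normr_ge0 CS) S_le T1_le T0_le S_T1 S_T0.
have [v v0] : exists v : V0, v <> 0.
  have [v [f [v1 _ _]]] := infinite_dim_biorthogonal V0_inf; exists (v 0%N) => v00.
  by have /eqP := v1 0%N; rewrite v00 nrm0 eq_sym oner_eq0.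
have [P [Wlin Plin PE]] := @glued_projection R s X0 X1 V0 V1 S T1 T0 Z Y0 Y1 Q0 Q1
  Y0_sub Y1_sub Q0_lin Q1_lin S_ker.
have [E EE] := @glued_section R s X0 X1 V0 V1 S Z Y0 Y1 Q0 Q1
  Y0_sub Y1_sub Q0_lin Q1_lin Q0_lift S_ker.
have key (I : interp_method R s) theta c c1 : 0 < theta < 1 -> 0 <= c ->
    exponential_bound I theta c -> 0 < c1 -> norm_bounds I c1 ->
    [/\ subspace_of (I A) `<=` liftable S T1 T0 Y0 Y1,
        forall a, nrm (P (emb (I A) a)) <= c1 * nrm a
      & exists CE, [/\ 0 <= CE,
          forall z, exists a, emb (I A) a = E z /\ nrm a <= CE * nrm z
        & c = 1 -> c1 = 1 -> tau0 <= theta -> tau0 <= 1 - theta -> CE <= 1 + 7 * eta]].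
  move=> t01 c0 Iexp c10 Ibd; have /andP[t0 t1] := t01; split.
  - exact: (interp_liftable S_ker R0_le R0_ker R1_le R1_ker t01 c0 Iexp).
  - by move=> a; apply: (projection_le Q0_le Q1_le S_ker R0_le R0_ker R1_le R1_ker
      t01 c0 c10 Iexp Ibd a PE).
  have [|B1 [B10 B1_eta kappa1B]] := kappa1_le theta; first by rewrite t0 ltW.
  have [|B0 [B00 B0_eta kappa0B]] := kappa0_le (1 - theta).
    by rewrite subr_gt0 t1 lerBlDr lerDl ltW.
  exists (c * c1 * ((1 + eta + B1 + B0) * (1 + eta))); split.
  - by rewrite !mulr_ge0 ?addr_ge0// ltW.
  - move=> z; apply: (section_le (normr_ge0 CS) S_le T1_le T0_le S_T1 S_T0 Y0_sub Y1_sub Q0_lin Q1_lin Q0_lift Q1_lift S_ker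
      t01 c0 c10 Iexp Ibd v0 T1_eta T0_eta eta0 B00 B10 kappa1_ker kappa0_ker
      kappa1_sum kappa0_sum kappa1B) => // n y.
    by have := kappa0B n y; rewrite opprB addrCA subrr addr0.
  move=> -> -> /B1_eta B1e /B0_eta B0e; rewrite !mul1r.
  apply: (@le_trans _ _ ((1 + 3 * eta) * (1 + eta))); last by nra.
  by rewrite ler_wpM2r ?addr_ge0 ?(ltW eta0)//; lra.
exists A, (liftable S T1 T0 Y0 Y1), P, E.
have PEz z : P (E z) = z.
  have [y [Yy Qy _]] := Q0_lift z 1 ltr01.
  have Y10 : Y1 0 by case: Y1_sub.
  by rewrite (EE z y)// (section_decomposition S T1 T0) PE//= Q10 addr0.
split=> //.
- split=> //.
  + by move=> w [p [q [_ ->]]]; rewrite /A sum_space_glued; exists p, q.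
  + move=> z; have [y [Yy Qy _]] := Q0_lift z 1 ltr01.
    exists (y, 0), (0, - T1 y); rewrite (EE z y)// (section_decomposition S T1 T0).
    by split=> //; split=> //; case: Y1_sub.
- exact: l1prod_isometric.
- exact: l1prod_isometric.
move=> I theta [t01 [c [c0 Iexp]]]; have [c1 [c10 Ibd]] := interp_bounds I.
have [IW PI [CE [CE0 EI _]]] := key I theta c c1 t01 (ltW c0) Iexp c10 Ibd.
have exact_case : exact_exponential I theta -> theta0 <= theta <= theta1 ->
    (forall a, nrm (P (emb (I A) a)) <= 1 * nrm a) /\
    forall z, exists a, emb (I A) a = E z /\ nrm a <= (1 + 7 * eta) * nrm z.
  move=> [_ Ibd1 Iexp1] /andP[t0 t1].
  have [_ PI1 [CE1 [_ EI1 CE1_le]]] := key I theta 1 1 t01 ler01 Iexp1 ltr01 Ibd1.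
  split=> // z; have [a [aE na]] := EI1 z; exists a; split=> //.
  rewrite (le_trans na)// ler_wpM2r ?nrm_ge0// CE1_le// /tau0 ge_min ?t0//.
  by apply/orP; right; lra.
have eta7 : 0 <= 1 + 7 * eta by lra.
split.
- split=> //.
  + by apply: le_lt_trans (opnorm_subspace PI (ltW c10)) _; rewrite ltry.
  + move=> Iex t; have [PI1 _] := exact_case Iex t.
    by apply: le_lt_trans (opnorm_subspace PI1 ler01) _; rewrite lte_fin; lra.
- split.
  + exact: range_section EI.
  + by apply: le_lt_trans (opnorm_section EI CE0) _; rewrite ltry.
  + move=> Iex t; have [_ EI1] := exact_case Iex t.
    by apply: le_lt_trans (opnorm_section EI1 eta7) _; rewrite lte_fin /eta; lra.
- exact: (complemented_copies IW Plin PEz EI PI CE0 (ltW c10)).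
- move=> Iex t; have [PI1 EI1] := exact_case Iex t.
  apply: (complemented_copies_by IW Plin PEz EI1 PI1 eta7 ler01).
  by rewrite mulr1 /eta; lra.
Qed.
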